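(* Let $1\le d\le m$. Define $X_d\in U(\mathfrak{g})^K$ by $$X_d=\sum_{S\in\mathcal{I}^m_d}\mathrm{Det}\left(\left(\mathbf{E}^X+{}^t\mathbf{E}^Y-\tfrac{p-q}{2}1_m\right)_{S,S}\right)$$ and $C_d\in U(\mathfrak{m})^H$ by $$C_d=\sum_{l=0}^d\frac{(m-l)!}{d!\,(m-d)!}\sum_{J\in\mathcal{I}^{p+q}_l}c^d_J\ \mathrm{Det}_{p,q}\left(\left(\mathbf{B}-\tfrac m2I_{p,q}\right)_{J,J};\ l-1,l-2,\ldots,0\right).$$ Then $$\omega(X_d)=\sum_{l=0}^d\frac{(m-l)!}{d!\,(m-d)!}\sum_{J\in\mathcal{I}^{p+q}_l}c^d_J\sum_{S\in\mathcal{I}^m_l}\det P_{S,J}\,\det Q_{S,J}=\omega(C_d).$$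
   Context: Let $m$ be a positive integer and $p,q$ non-negative integers. Let $V=\mathrm{Mat}(m,p;\mathbb{C})\oplus\mathrm{Mat}(m,q;\mathbb{C})$ with linear coordinates $x_{s,i}$ ($1\le s\le m$, $1\le i\le p$) and $y_{s,i}$ ($1\le s\le m$, $1\le i\le q$), and let $\mathcal{PD}(V)$ be the ring of differential operators with polynomial coefficients on $V$. Put $\partial^X_{s,i}=\partial/\partial x_{s,i}$, $\partial^Y_{s,i}=\partial/\partial y_{s,i}$, and let $X=(x_{s,i})$, $\partial^X=(\partial^X_{s,i})$, $Y=(y_{s,i})$, $\partial^Y=(\partial^Y_{s,i})$. Put $P=(X,\partial^Y)$ and $Q=(\partial^X,Y)$, which are $m\times(p+q)$ matrices with entries in $\mathcal{PD}(V)$. The entries of $P$ commute with each other, and so do those of $Q$, so their minors are ordinary determinants. For $n,d\ge 0$, $\mathcal{I}^n_d$ is the set of $d$-element subsets of $\{1,\ldots,n\}$; elements of $J\in\mathcal{I}^n_d$ are written in increasing order $J(1)<\cdots<J(d)$. $A_{S,T}$ denotes the submatrix of $A$ with rows in $S$ and columns in $T$. Empty determinants are $1$. $I_{p,q}=\mathrm{diag}(1_p,-1_q)$. ${}^tA$ is the transpose. Lie algebras: $\mathfrak{g}=\mathfrak{gl}_m(\mathbb{C})\oplus\mathfrak{gl}_m(\mathbb{C})$, and $K=GL_m(\mathbb{C})$ acts on $U(\mathfrak{g})$ by the adjoint action, with Lie algebra $\mathfrak{k}=\{(A,-{}^tA)\}\subset\mathfrak{g}$. $\mathfrak{m}=\mathfrak{gl}_{p+q}(\mathbb{C})$,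 and $H=GL_p(\mathbb{C})\times GL_q(\mathbb{C})$ (block diagonal) acts on $U(\mathfrak{m})$ by the adjoint action. $U(\mathfrak{g})^K$ and $U(\mathfrak{m})^H$ are the invariant subalgebras. Writing $E_{a,b}$ for matrix units, put $\mathbf{E}^X=((E_{s,t},0))_{1\le s,t\le m}$, $\mathbf{E}^Y=((0,E_{s,t}))_{1\le s,t\le m}$ (matrices over $U(\mathfrak{g})$), $\mathbf{B}'=(E_{i,j})_{1\le i,j\le p+q}$ and $\mathbf{B}=D\mathbf{B}'D$ with $D=\mathrm{diag}(1_p,-\sqrt{-1}\,1_q)$ (matrices over $U(\mathfrak{m})$). Weil representation: $\omega$ denotes both algebra homomorphisms $U(\mathfrak{g})\to\mathcal{PD}(V)$ and $U(\mathfrak{m})\to\mathcal{PD}(V)$ determined by $\omega((E_{s,t},0))=\sum_{i=1}^p x_{s,i}\partial^X_{t,i}+\frac p2\delta_{s,t}$, $\ \omega((0,E_{s,t}))=\sum_{i=1}^q y_{s,i}\partial^Y_{t,i}+\frac q2\delta_{s,t}$, and, in block form of size $p+q$, $\omega\begin{pmatrix}E_{i,j}&0\\0&0\end{pmatrix}=\sum_{s=1}^m x_{s,i}\partial^X_{s,j}+\frac m2\delta_{i,j}$, $\ \omega\begin{pmatrix}0&0\\0&E_{i,j}\end{pmatrix}=-\sum_{s=1}^m y_{s,j}\partial^Y_{s,i}-\frac m2\delta_{i,j}$, $\ \omega\begin{pmatrix}0&E_{i,j}\\0&0\end{pmatrix}=\sqrt{-1}\sum_{s=1}^m x_{s,i}y_{s,j}$,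 $\ \omega\begin{pmatrix}0&0\\ E_{j,i}&0\end{pmatrix}=\sqrt{-1}\sum_{s=1}^m\partial^X_{s,i}\partial^Y_{s,j}$. Symmetrized determinant of an $n\times n$ matrix over a possibly noncommutative $\mathbb{C}$-algebra: $$\mathrm{Det}(A)=\frac1{n!}\sum_{\sigma,\tau\in\mathfrak{S}_n}\mathrm{sgn}(\sigma)\,\mathrm{sgn}(\tau)\,A_{\sigma(1),\tau(1)}A_{\sigma(2),\tau(2)}\cdots A_{\sigma(n),\tau(n)}.$$ Symmetrized minor with uneven diagonal shift: with $\varepsilon=-I_{p,q}$ (entries $\varepsilon_{i,j}$), for a $(p+q)\times(p+q)$ matrix $B$, $I=\{i_1<\cdots<i_l\}$, $J=\{j_1<\cdots<j_l\}$ in $\mathcal{I}^{p+q}_l$ and $u=(u_1,\ldots,u_l)$, $$\mathrm{Det}_{p,q}(B_{I,J};u)=\frac1{l!}\sum_{\sigma,\tau\in\mathfrak{S}_l}\mathrm{sgn}(\sigma)\,\mathrm{sgn}(\tau)\prod_{k=1}^l\left(B_{i_{\sigma(k)},j_{\tau(k)}}-u_k\,\varepsilon_{i_{\sigma(k)},j_{\tau(k)}}\right),$$ with factors in the order $k=1,\ldots,l$ from left to right. Coefficients: for $J\in\mathcal{I}^{p+q}_l$ let $\alpha=\#\{i: 1\le J(i)\le p\}$ and $\beta=\#\{i: p+1\le J(i)\le p+q\}$ (so $\alpha+\beta=l$), and set $$c^d_J=c^d_{\alpha,\beta}=\sum_{k\in\mathbb{Z}}\binom{\alpha+\beta}{k}(\beta-k)^d(-1)^k,$$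 where $\binom{n}{k}=0$ unless $0\le k\le n$. *)

(* Defs.v *)
From HB Require Import structures.
From mathcomp Require Import all_boot all_order all_algebra.
From mathcomp Require Import perm boolp reals complex mpoly ring.

Set Implicit Arguments.
Unset Strict Implicit.
Unset Printing Implicit Defensive.

Import Order.TTheory GRing.Theory Num.Theory.
Local Open Scope ring_scope.

HB.mixin Record Lmodule_isLie (R : comNzRingType) L of GRing.Lmodule R L := {
  lie_br : L -> L -> L;
  lie_brDl : forall (a : R) x y z,
    lie_br (a *: x + y) z = a *: lie_br x z + lie_br y z;
  lie_brDr : forall (a : R) x y z,
    lie_br z (a *: x + y) = a *: lie_br z x + lie_br z y;
  lie_brxx : forall x, lie_br x x = 0;
  lie_jacobi : forall x y z,
    lie_br x (lie_br y z) + lie_br y (lie_br z x) + lie_br z (lie_br x y) = 0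
}.

#[short(type="lieAlgType")]
HB.structure Definition LieAlgebra (R : comNzRingType) :=
  {L of GRing.Lmodule R L & Lmodule_isLie R L}.

Section MatrixLie.
Variables (R : comNzRingType) (n : nat).
Implicit Types A B C : 'M[R]_n.

Definition mx_br A B : 'M[R]_n := A *m B - B *m A.

Lemma mx_brDl a A B C : mx_br (a *: A + B) C = a *: mx_br A C + mx_br B C.
Proof.
rewrite /mx_br mulmxDl mulmxDr -scalemxAl -scalemxAr scalerBr opprD.
by rewrite addrACA.
Qed.

Lemma mx_brDr a A B C : mx_br C (a *: A + B) = a *: mx_br C A + mx_br C B.
Proof.
rewrite /mx_br mulmxDl mulmxDr -scalemxAl -scalemxAr scalerBr opprD.
by rewrite addrACA.
Qed.

Lemma mx_brxx A : mx_br A A = 0.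
Proof. exact: subrr. Qed.

Lemma mx_jacobi A B C :
  mx_br A (mx_br B C) + mx_br B (mx_br C A) + mx_br C (mx_br A B) = 0.
Proof.
rewrite /mx_br !mulmxBr !mulmxBl !mulmxA.
set a := A *m B *m C; set b := A *m C *m B; set c := B *m C *m A.
set d := C *m B *m A; set e := B *m A *m C; set f := C *m A *m B.
by apply/matrixP => i j; rewrite !mxE; ring.
Qed.

HB.instance Definition _ :=
  Lmodule_isLie.Build R 'M[R]_n mx_brDl mx_brDr mx_brxx mx_jacobi.

End MatrixLie.

Section ProductLie.
Variables (R : comNzRingType) (L1 L2 : lieAlgType R).
Implicit Types x y z : (L1 * L2)%type.

Definition pair_br x y : (L1 * L2)%type := (lie_br x.1 y.1, lie_br x.2 y.2).

Lemma pair_brDl (a : R) x y z :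
  pair_br (a *: x + y) z = a *: pair_br x z + pair_br y z.
Proof. by rewrite /pair_br /= !lie_brDl. Qed.

Lemma pair_brDr (a : R) x y z :
  pair_br z (a *: x + y) = a *: pair_br z x + pair_br z y.
Proof. by rewrite /pair_br /= !lie_brDr. Qed.

Lemma pair_brxx x : pair_br x x = 0.
Proof. by rewrite /pair_br !lie_brxx. Qed.

Lemma pair_jacobi x y z :
  pair_br x (pair_br y z) + pair_br y (pair_br z x) + pair_br z (pair_br x y)
    = 0.
Proof. by congr pair => /=; exact: lie_jacobi. Qed.

HB.instance Definition _ := Lmodule_isLie.Build R (L1 * L2)%type
  pair_brDl pair_brDr pair_brxx pair_jacobi.

End ProductLie.

Definition lie_hom (R : comNzRingType) (L L' : lieAlgType R) (f : L -> L') :=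
  (forall (a : R) x y, f (a *: x + y) = a *: f x + f y) /\
  (forall x y, f (lie_br x y) = lie_br (f x) (f y)).

Definition lie_rep (R : comNzRingType) (L : lieAlgType R) (A : algType R)
    (f : L -> A) :=
  (forall (a : R) x y, f (a *: x + y) = a *: f x + f y) /\
  (forall x y, f (lie_br x y) = f x * f y - f y * f x).

(** The universal enveloping algebra: [uea L] is the unital associative [R]-algebra presented by the generators
   [x : L], subject to the linearity relations [a x + y = a . x + y] and to
   [lie_br x y = x * y - y * x].  It is the quotient of the algebra expressions
   by the smallest congruence containing the algebra axioms and these relations;
   its universal property is [uea_lift], [uea_lift_iota], [uea_lift_uniq]. *)

Section UEA.
Local Open Scope quotient_scope.
Variables (R : comNzRingType) (L : lieAlgType R).

Inductive uterm : Type :=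
| UCst of R
| UGen of L
| UAdd of uterm & uterm
| UMul of uterm & uterm.

Inductive ucong : uterm -> uterm -> Prop :=
| uc_refl t : ucong t t
| uc_sym t u : ucong t u -> ucong u t
| uc_trans t u v : ucong t u -> ucong u v -> ucong t v
| uc_add t t' u u' : ucong t t' -> ucong u u' -> ucong (UAdd t u) (UAdd t' u')
| uc_mul t t' u u' : ucong t t' -> ucong u u' -> ucong (UMul t u) (UMul t' u')
| uc_addA t u v : ucong (UAdd t (UAdd u v)) (UAdd (UAdd t u) v)
| uc_addC t u : ucong (UAdd t u) (UAdd u t)
| uc_add0 t : ucong (UAdd (UCst 0) t) t
| uc_addN t : ucong (UAdd (UMul (UCst (-1)) t) t) (UCst 0)
| uc_mulA t u v : ucong (UMul t (UMul u v)) (UMul (UMul t u) v)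
| uc_1mul t : ucong (UMul (UCst 1) t) t
| uc_mulDl t u v : ucong (UMul (UAdd t u) v) (UAdd (UMul t v) (UMul u v))
| uc_mulDr t u v : ucong (UMul v (UAdd t u)) (UAdd (UMul v t) (UMul v u))
| uc_cstD a b : ucong (UCst (a + b)) (UAdd (UCst a) (UCst b))
| uc_cstM a b : ucong (UCst (a * b)) (UMul (UCst a) (UCst b))
| uc_cstC a t : ucong (UMul (UCst a) t) (UMul t (UCst a))
| uc_lin a x y :
    ucong (UGen (a *: x + y)) (UAdd (UMul (UCst a) (UGen x)) (UGen y))
| uc_br x y :
    ucong (UGen (lie_br x y))
      (UAdd (UMul (UGen x) (UGen y))
            (UMul (UCst (-1)) (UMul (UGen y) (UGen x)))).

HB.instance Definition _ := gen_eqMixin uterm.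
HB.instance Definition _ := gen_choiceMixin uterm.

Definition ucongb (t u : uterm) : bool := `[< ucong t u >].

Lemma ucongb_equiv : equiv_class_of ucongb.
Proof.
split=> [t|t u|u t v]; first exact/asboolP/uc_refl.
  by apply/asboolP/asboolP; exact: uc_sym.
by move=> /asboolP tu /asboolP uv; apply/asboolP; exact: uc_trans tu uv.
Qed.

Canonical ucong_rel := EquivRelPack ucongb_equiv.

Definition uea : Type := {eq_quot ucong_rel}.

HB.instance Definition _ := Choice.on uea.
HB.instance Definition _ := Quotient.on uea.

Lemma uea_piP (t u : uterm) : ucong t u <-> \pi_uea t = \pi_uea u.
Proof.
split=> [tu|/eqmodP/asboolP//].
by apply/eqmodP/asboolP.
Qed.

Lemma ucong_repr t : ucong (repr (\pi_uea t)) t.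
Proof. by apply/uea_piP; rewrite reprK. Qed.

Definition ucst (a : R) : uea := \pi_uea (UCst a).
Definition uea_iota (x : L) : uea := \pi_uea (UGen x).
Definition uadd : uea -> uea -> uea :=
  locked (fun u v => \pi_uea (UAdd (repr u) (repr v))).
Definition umul : uea -> uea -> uea :=
  locked (fun u v => \pi_uea (UMul (repr u) (repr v))).

Lemma pi_uadd t u : uadd (\pi_uea t) (\pi_uea u) = \pi_uea (UAdd t u).
Proof. by rewrite /uadd -lock; apply/uea_piP; apply: uc_add; exact: ucong_repr. Qed.

Lemma pi_umul t u : umul (\pi_uea t) (\pi_uea u) = \pi_uea (UMul t u).
Proof. by rewrite /umul -lock; apply/uea_piP; apply: uc_mul; exact: ucong_repr. Qed.

Let uE := (pi_uadd, pi_umul).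

Lemma uaddA : associative uadd.
Proof.
by move=> u v w; rewrite -[u]reprK -[v]reprK -[w]reprK !uE; exact/uea_piP/uc_addA.
Qed.
Lemma uaddC : commutative uadd.
Proof. by move=> u v; rewrite -[u]reprK -[v]reprK !uE; exact/uea_piP/uc_addC. Qed.
Lemma uadd0 : left_id (ucst 0) uadd.
Proof. by move=> u; rewrite -[u]reprK !uE; exact/uea_piP/uc_add0. Qed.
Lemma uaddN : left_inverse (ucst 0) (umul (ucst (-1))) uadd.
Proof. by move=> u; rewrite -[u]reprK !uE; exact/uea_piP/uc_addN. Qed.
Lemma umulA : associative umul.
Proof.
by move=> u v w; rewrite -[u]reprK -[v]reprK -[w]reprK !uE; exact/uea_piP/uc_mulA.
Qed.
Lemma ucstC a u : umul (ucst a) u = umul u (ucst a).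
Proof. by rewrite -[u]reprK !uE; exact/uea_piP/uc_cstC. Qed.
Lemma u1mul : left_id (ucst 1) umul.
Proof. by move=> u; rewrite -[u]reprK !uE; exact/uea_piP/uc_1mul. Qed.
Lemma umul1 : right_id (ucst 1) umul.
Proof. by move=> u; rewrite -ucstC u1mul. Qed.
Lemma umulDl : left_distributive umul uadd.
Proof.
by move=> u v w; rewrite -[u]reprK -[v]reprK -[w]reprK !uE; exact/uea_piP/uc_mulDl.
Qed.
Lemma umulDr : right_distributive umul uadd.
Proof.
by move=> u v w; rewrite -[u]reprK -[v]reprK -[w]reprK !uE; exact/uea_piP/uc_mulDr.
Qed.
Lemma ucstD a b : ucst (a + b) = uadd (ucst a) (ucst b).
Proof. by rewrite /ucst !uE; exact/uea_piP/uc_cstD. Qed.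
Lemma ucstM a b : ucst (a * b) = umul (ucst a) (ucst b).
Proof. by rewrite /ucst !uE; exact/uea_piP/uc_cstM. Qed.

Section Eval.
Variables (A : algType R) (f : L -> A).

Fixpoint ueval (t : uterm) : A :=
  match t with
  | UCst a => a%:A
  | UGen x => f x
  | UAdd t u => ueval t + ueval u
  | UMul t u => ueval t * ueval u
  end.

Lemma ueval_cong : lie_rep f -> forall t u, ucong t u -> ueval t = ueval u.
Proof.
move=> [flin fbr] t u; elim=> //=; clear t u.
- by move=> t u v _ -> _ ->.
- by move=> t t' u u' _ -> _ ->.
- by move=> t t' u u' _ -> _ ->.
- by move=> t u v; rewrite addrA.
- by move=> t u; rewrite addrC.
- by move=> t; rewrite scale0r add0r.
- by move=> t; rewrite scaleN1r mulN1r addNr scale0r.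
- by move=> t u v; rewrite mulrA.
- by move=> t; rewrite scale1r mul1r.
- by move=> t u v; rewrite mulrDl.
- by move=> t u v; rewrite mulrDr.
- by move=> a b; rewrite scalerDl.
- by move=> a b; rewrite mulr_algl scalerA.
- by move=> a t; rewrite mulr_algl mulr_algr.
- by move=> a x y; rewrite flin mulr_algl.
- by move=> x y; rewrite fbr scaleN1r mulN1r.
Qed.

End Eval.

Lemma ucst_inj : injective ucst.
Proof.
move=> a b /uea_piP/(@ueval_cong R^o (fun=> 0)) /= ab.
by move: ab; rewrite /GRing.scale /= !mulr1; apply; split=> *; rewrite !(mulr0, addr0, subr0, scaler0).
Qed.

HB.instance Definition _ := GRing.isZmodule.Build uea uaddA uaddC uadd0 uaddN.

Lemma uone_neq0 : ucst 1 != 0 :> uea.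
Proof. by apply/eqP => /ucst_inj/eqP; rewrite oner_eq0. Qed.

HB.instance Definition _ := GRing.Zmodule_isNzRing.Build uea
  umulA u1mul umul1 umulDl umulDr uone_neq0.

Definition uscale (a : R) (u : uea) : uea := ucst a * u.

Lemma uscaleA a b u : uscale a (uscale b u) = uscale (a * b) u.
Proof. by rewrite /uscale mulrA; congr (_ * _); rewrite ucstM. Qed.
Lemma uscale1 : left_id 1 uscale.
Proof. exact: u1mul. Qed.
Lemma uscaleDr : right_distributive uscale +%R.
Proof. by move=> a u v; exact: mulrDr. Qed.
Lemma uscaleDl u : {morph uscale^~ u : a b / a + b}.
Proof. by move=> a b; rewrite /uscale -mulrDl; congr (_ * _); rewrite ucstD. Qed.

HB.instance Definition _ := GRing.Zmodule_isLmodule.Build R uea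
  uscaleA uscale1 uscaleDr uscaleDl.

Lemma uscaleAl (a : R) (u v : uea) : a *: (u * v) = a *: u * v.
Proof. exact: mulrA. Qed.

HB.instance Definition _ := GRing.Lmodule_isLalgebra.Build R uea uscaleAl.

Lemma uscaleAr (a : R) (u v : uea) : a *: (u * v) = u * (a *: v).
Proof.
by rewrite /GRing.scale /= /uscale mulrA [in RHS]mulrA; congr (_ * _); exact: ucstC.
Qed.

HB.instance Definition _ := GRing.Lalgebra_isAlgebra.Build R uea uscaleAr.

Lemma uea_iota_rep : lie_rep uea_iota.
Proof.
split=> [a x y|x y].
  by rewrite /GRing.scale /GRing.add /= /uscale /GRing.mul /= !uE; exact/uea_piP/uc_lin.
rewrite /GRing.add /GRing.opp /GRing.mul /= !uE; exact/uea_piP/uc_br.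
Qed.

Section Lift.
Variables (A : algType R) (f : L -> A) (hf : lie_rep f).

Definition uea_lift of lie_rep f := fun u : uea => ueval f (repr u).

Lemma uea_lift_pi t : uea_lift hf (\pi_uea t) = ueval f t.
Proof. by apply: ueval_cong => //; exact: ucong_repr. Qed.

Lemma uea_lift_linear : linear (uea_lift hf).
Proof.
move=> a u v; rewrite -[u]reprK -[v]reprK.
rewrite /GRing.scale /GRing.add /= /uscale /GRing.mul /= !uE !uea_lift_pi /=.
by rewrite mulr_algl.
Qed.

Lemma uea_lift_monoid_morphism : monoid_morphism (uea_lift hf).
Proof.
split; first by rewrite /GRing.one /= uea_lift_pi /= scale1r.
move=> u v; rewrite -[u]reprK -[v]reprK.
by rewrite {1}/GRing.mul /= !uE !uea_lift_pi.
Qed.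

HB.instance Definition _ :=
  GRing.isLinear.Build R uea A *:%R (uea_lift hf) uea_lift_linear.
HB.instance Definition _ :=
  GRing.isMonoidMorphism.Build uea A (uea_lift hf) uea_lift_monoid_morphism.

Lemma uea_lift_iota x : uea_lift hf (uea_iota x) = f x.
Proof. exact: uea_lift_pi. Qed.

Lemma uea_lift_uniq (g : {lrmorphism uea -> A}) :
  (forall x, g (uea_iota x) = f x) -> g =1 uea_lift hf.
Proof.
move=> gf u; rewrite -[u]reprK uea_lift_pi.
elim: (repr u) => [a|x|t IHt s IHs|t IHt s IHs] /=.
- rewrite -[in RHS](rmorph1 g) -linearZ; congr (g _).
  by rewrite /GRing.scale /= /uscale mulr1.
- exact: gf.
- by rewrite -IHt -IHs -rmorphD -pi_uadd.
- by rewrite -IHt -IHs -rmorphM -pi_umul.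
Qed.

End Lift.
End UEA.

Lemma lie_hom_rep (R : comNzRingType) (L L' : lieAlgType R) (f : L -> L') :
  lie_hom f -> lie_rep (fun x => uea_iota (f x)).
Proof.
move=> [flin fbr]; have [ilin ibr] := uea_iota_rep L'.
by split=> *; rewrite ?flin ?fbr ?ilin ?ibr.
Qed.

Definition uea_map (R : comNzRingType) (L L' : lieAlgType R) (f : L -> L')
    (hf : lie_hom f) : {lrmorphism uea L -> uea L'} :=
  uea_lift (lie_hom_rep hf).

(** Differential operators with polynomial coefficients in [n] variables: the
   operators on polynomials generated, under sum and composition, by the
   multiplications and the partial derivatives. *)

Section DiffOp.
Variables (R : comNzRingType) (n : nat).
Notation poln := {mpoly R[n]}.

Inductive is_diffop : (poln -> poln) -> Prop :=
| DO_mul (f : poln) : is_diffop (fun g => f * g)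
| DO_deriv (i : 'I_n) : is_diffop (fun g => mderiv i g)
| DO_add D E : is_diffop D -> is_diffop E -> is_diffop (fun g => D g + E g)
| DO_comp D E : is_diffop D -> is_diffop E -> is_diffop (fun g => D (E g)).

Record diffop : Type :=
  DiffOp { diffop_fun :> poln -> poln; diffopP : is_diffop diffop_fun }.

HB.instance Definition _ := gen_eqMixin diffop.
HB.instance Definition _ := gen_choiceMixin diffop.

Lemma diffop_eq (D E : diffop) : (forall g, D g = E g) -> D = E.
Proof.
case: D E => [D hD] [E hE] /= /funext DE; rewrite DE in hD *.
by congr DiffOp; exact: Prop_irrelevance.
Qed.

Lemma is_diffop_linear D : is_diffop D ->
  forall (a : R) g h, D (a *: g + h) = a *: D g + D h.
Proof.
elim=> {D} [f|i|D E _ IHD _ IHE|D E _ IHD _ IHE] a g h.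
- by rewrite mulrDr scalerAr.
- by rewrite mderivD mderivZ.
- by rewrite IHD IHE scalerDr addrACA.
- by rewrite IHE IHD.
Qed.

Definition do_mul (f : poln) : diffop := DiffOp (DO_mul f).
Definition do_deriv (i : 'I_n) : diffop := DiffOp (DO_deriv i).
Definition do_add (D E : diffop) : diffop :=
  DiffOp (DO_add (diffopP D) (diffopP E)).
Definition do_comp (D E : diffop) : diffop :=
  DiffOp (DO_comp (diffopP D) (diffopP E)).

Lemma diffopD (D : diffop) g h : D (g + h) = D g + D h.
Proof. by rewrite -[g]scale1r (is_diffop_linear (diffopP D)) !scale1r. Qed.

Lemma diffop0 (D : diffop) : D 0 = 0.
Proof. by apply: (addrI (D 0)); rewrite -diffopD !addr0. Qed.

Lemma diffopZ (D : diffop) (a : R) g : D (a *: g) = a *: D g.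
Proof. by rewrite -[a *: g]addr0 (is_diffop_linear (diffopP D)) diffop0 addr0. Qed.

Lemma do_addA : associative do_add.
Proof. by move=> D E F; apply: diffop_eq => g /=; rewrite addrA. Qed.
Lemma do_addC : commutative do_add.
Proof. by move=> D E; apply: diffop_eq => g /=; rewrite addrC. Qed.
Lemma do_add0 : left_id (do_mul 0) do_add.
Proof. by move=> D; apply: diffop_eq => g /=; rewrite mul0r add0r. Qed.
Lemma do_addN : left_inverse (do_mul 0) (do_comp (do_mul (-1))) do_add.
Proof. by move=> D; apply: diffop_eq => g /=; rewrite mulN1r addNr mul0r. Qed.

HB.instance Definition _ :=
  GRing.isZmodule.Build diffop do_addA do_addC do_add0 do_addN.

Lemma do_compA : associative do_comp.
Proof. by move=> D E F; apply: diffop_eq. Qed.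
Lemma do_comp1l : left_id (do_mul 1) do_comp.
Proof. by move=> D; apply: diffop_eq => g /=; rewrite mul1r. Qed.
Lemma do_comp1r : right_id (do_mul 1) do_comp.
Proof. by move=> D; apply: diffop_eq => g /=; rewrite mul1r. Qed.
Lemma do_compDl : left_distributive do_comp do_add.
Proof. by move=> D E F; apply: diffop_eq. Qed.
Lemma do_compDr : right_distributive do_comp do_add.
Proof. by move=> D E F; apply: diffop_eq => g /=; rewrite diffopD. Qed.
Lemma do_one_neq0 : do_mul 1 != 0 :> diffop.
Proof.
apply/eqP => /(congr1 (fun D : diffop => D 1)) /= /eqP.
by rewrite !mulr1 oner_eq0.
Qed.

HB.instance Definition _ := GRing.Zmodule_isNzRing.Build diffop
  do_compA do_comp1l do_comp1r do_compDl do_compDr do_one_neq0.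

Definition do_scale (a : R) (D : diffop) : diffop := do_mul a%:MP * D.

Lemma do_scaleE a D g : do_scale a D g = a *: D g.
Proof. by rewrite /= mul_mpolyC. Qed.

Lemma do_scaleA a b D : do_scale a (do_scale b D) = do_scale (a * b) D.
Proof. by apply: diffop_eq => g; rewrite !do_scaleE scalerA. Qed.
Lemma do_scale1 : left_id 1 do_scale.
Proof. by move=> D; apply: diffop_eq => g; rewrite do_scaleE scale1r. Qed.
Lemma do_scaleDr : right_distributive do_scale +%R.
Proof. by move=> a D E; exact: mulrDr. Qed.
Lemma do_scaleDl D : {morph do_scale^~ D : a b / a + b}.
Proof.
move=> a b; apply: diffop_eq => g.
by rewrite [RHS]/= -!/(do_scale _ _ _) !do_scaleE scalerDl /= !mul_mpolyC.
Qed.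

HB.instance Definition _ := GRing.Zmodule_isLmodule.Build R diffop
  do_scaleA do_scale1 do_scaleDr do_scaleDl.

Lemma do_scaleAl (a : R) (D E : diffop) : a *: (D * E) = a *: D * E.
Proof. exact: mulrA. Qed.

HB.instance Definition _ := GRing.Lmodule_isLalgebra.Build R diffop do_scaleAl.

Lemma do_scaleAr (a : R) (D E : diffop) : a *: (D * E) = D * (a *: E).
Proof. by apply: diffop_eq => g /=; rewrite !mul_mpolyC diffopZ. Qed.

HB.instance Definition _ := GRing.Lalgebra_isAlgebra.Build R diffop do_scaleAr.

Definition do_var (i : 'I_n) : diffop := do_mul 'X_i.

Lemma do_addE (D E : diffop) g : (D + E) g = D g + E g.
Proof. by []. Qed.
Lemma do_compE (D E : diffop) g : (D * E) g = D (E g).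
Proof. by []. Qed.
Lemma do_oppE (D : diffop) g : (- D) g = - D g.
Proof. by rewrite /= mulN1r. Qed.
Lemma do_oneE g : (1 : diffop) g = g.
Proof. by rewrite /= mul1r. Qed.

Lemma do_ZE (a : R) (D : diffop) g : (a *: D) g = a *: D g.
Proof. exact: do_scaleE. Qed.

Lemma do_varC i j : do_var i * do_var j = do_var j * do_var i.
Proof. by apply: diffop_eq => g /=; rewrite mulrCA. Qed.
Lemma do_derivC i j : do_deriv i * do_deriv j = do_deriv j * do_deriv i.
Proof. by apply: diffop_eq => g /=; rewrite mderiv_comm. Qed.
Lemma do_deriv_var i j :
  do_deriv i * do_var j - do_var j * do_deriv i = ((i == j)%:R : R)%:A.
Proof.
apply: diffop_eq => g; rewrite do_ZE do_oneE do_addE do_oppE /= mderivM addrK.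
rewrite mderivX mnmE eq_sym; case: eqVneq => [->|_]; last first.
  by rewrite !scale0r mul0r.
set z := (X in 'X_[X]); rewrite !scale1r (_ : z = 0%MM) ?mpolyX0 ?mul1r //.
by apply/mnmP => k; rewrite mnmBE mnm0E subnn.
Qed.

End DiffOp.

Section GlExt.
Variables (R : comNzRingType) (A : algType R).

(** The linear map sending the matrix unit [E_{a,b}] to [W a b]. *)
Definition gl_ext n (W : 'M[A]_n) (M : 'M[R]_n) : A :=
  \sum_(a < n) \sum_(b < n) M a b *: W a b.

Lemma gl_ext_linear n (W : 'M[A]_n) (c : R) M N :
  gl_ext W (c *: M + N) = c *: gl_ext W M + gl_ext W N.
Proof.
rewrite /gl_ext scaler_sumr -big_split; apply: eq_bigr => a _ /=.
rewrite scaler_sumr -big_split; apply: eq_bigr => b _ /=.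
by rewrite !mxE scalerDl scalerA.
Qed.

Lemma gl_extB n (W : 'M[A]_n) M N : gl_ext W (M - N) = gl_ext W M - gl_ext W N.
Proof. by rewrite addrC -scaleN1r gl_ext_linear scaleN1r addrC. Qed.

Lemma gl_ext_delta n (W : 'M[A]_n) a b : gl_ext W (delta_mx a b) = W a b.
Proof.
rewrite /gl_ext (bigD1 a) //= (bigD1 b) //= mxE !eqxx scale1r.
rewrite !big1 ?addr0 // => [c /negPf ca|c /negPf cb].
  by rewrite big1 // => d _; rewrite mxE ca scale0r.
by rewrite mxE cb andbF scale0r.
Qed.

Lemma gl_ext_mulE n (W W' : 'M[A]_n) M N :
  gl_ext W M * gl_ext W' N =
  \sum_a \sum_b \sum_c \sum_d (M a b * N c d) *: (W a b * W' c d).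
Proof.
rewrite /gl_ext mulr_suml; apply: eq_bigr => a _.
rewrite mulr_suml; apply: eq_bigr => b _.
rewrite mulr_sumr; apply: eq_bigr => c _.
rewrite mulr_sumr; apply: eq_bigr => d _.
by rewrite -scalerAl -scalerAr scalerA.
Qed.

Lemma gl_ext_comm n (W W' : 'M[A]_n) M N :
  (forall a b c d, W a b * W' c d = W' c d * W a b) ->
  gl_ext W M * gl_ext W' N = gl_ext W' N * gl_ext W M.
Proof.
move=> WC; rewrite /gl_ext mulr_suml mulr_sumr; apply: eq_bigr => a _.
rewrite mulr_suml mulr_sumr; apply: eq_bigr => b _.
rewrite mulr_suml mulr_sumr; apply: eq_bigr => c _.
rewrite mulr_suml mulr_sumr; apply: eq_bigr => d _.
by rewrite -!scalerAl -!scalerAr !scalerA WC mulrC.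
Qed.

Lemma exchange_big4 (V : nmodType) n n' (G : 'I_n -> 'I_n -> 'I_n' -> 'I_n' -> V) :
  \sum_a \sum_b \sum_c \sum_d G a b c d = \sum_c \sum_d \sum_a \sum_b G a b c d.
Proof.
transitivity (\sum_a \sum_c \sum_b \sum_d G a b c d).
  by apply: eq_bigr => a _; rewrite exchange_big.
rewrite exchange_big; apply: eq_bigr => c _ /=.
transitivity (\sum_a \sum_d \sum_b G a b c d).
  by apply: eq_bigr => a _; rewrite exchange_big.
by rewrite exchange_big.
Qed.

Lemma gl_ext_mulmx n (W : 'M[A]_n) (M N : 'M[R]_n) :
  \sum_a \sum_b \sum_c \sum_d (M a b * N c d) *: (((b == c)%:R : R) *: W a d)
    = gl_ext W (M *m N).
Proof.
apply: eq_bigr => a _; rewrite [RHS](eq_bigr _ (fun d _ => congr1 (fun x => x *: _) (mxE _ _ a d))).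
under [RHS]eq_bigr do rewrite scaler_suml.
rewrite [RHS]exchange_big; apply: eq_bigr => b _ /=.
rewrite (bigD1 b) //= [X in _ + X]big1 ?addr0 => [|c /negPf cb].
  by apply: eq_bigr => d _; rewrite eqxx scale1r.
by apply: big1 => d _; rewrite eq_sym cb scale0r scaler0.
Qed.

Lemma gl_ext_rep n (W : 'M[A]_n) :
  (forall a b c d, W a b * W c d - W c d * W a b =
     ((b == c)%:R : R) *: W a d - ((d == a)%:R : R) *: W c b) ->
  lie_rep (gl_ext W).
Proof.
move=> Wbr; split=> [|M N]; first exact: gl_ext_linear.
have -> : gl_ext W (lie_br M N) = gl_ext W (M *m N) - gl_ext W (N *m M).
  exact: gl_extB.
rewrite !gl_ext_mulE [X in _ = _ - X]exchange_big4.
rewrite -!gl_ext_mulmx [X in _ - X = _]exchange_big4.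
do 4![rewrite -!sumrB; apply: eq_bigr => ? _].
by rewrite ![N _ _ * M _ _]mulrC -!scalerBr Wbr.
Qed.

Lemma br_cst (r r' : R) (u v : A) :
  (u + r%:A) * (v + r'%:A) - (v + r'%:A) * (u + r%:A) = u * v - v * u.
Proof.
have cst1 (c : R) (x y : A) : (x + c%:A) * y - y * (x + c%:A) = x * y - y * x.
  by rewrite mulrDl mulrDr mulr_algl mulr_algr opprD addrACA subrr addr0.
by rewrite cst1 -opprB cst1 opprB.
Qed.

Lemma ccr_rep m n (phi psi : 'I_m -> 'I_n -> A) (k : R) :
  (forall s t a b, phi s a * phi t b = phi t b * phi s a) ->
  (forall s t a b, psi s a * psi t b = psi t b * psi s a) ->
  (forall s t a b, psi s a * phi t b - phi t b * psi s a =
     (((s == t) && (a == b))%:R : R)%:A) ->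
  lie_rep (gl_ext (\matrix_(a, b)
     (\sum_s phi s a * psi s b + (k * (a == b)%:R)%:A))).
Proof.
move=> phiC psiC psi_phi; apply: gl_ext_rep => a b c d; rewrite !mxE.
pose w a b := \sum_s phi s a * psi s b; rewrite -!/(w _ _).
rewrite br_cst.
have comm s t : phi s a * psi s b * (phi t c * psi t d) -
    phi t c * psi t d * (phi s a * psi s b) =
    (((s == t) && (b == c))%:R : R) *: (phi s a * psi t d) -
    (((t == s) && (d == a))%:R : R) *: (phi t c * psi s b).
  have scl (r : R) (u v : A) : r *: (u * v) = u * (r%:A * v).
    by rewrite mulr_algl scalerAr.
  rewrite !scl -(psi_phi s t b c) -(psi_phi t s d a) !mulrBl !mulrBr !mulrA.
  have -> : phi s a * phi t c * psi s b * psi t d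
          = phi t c * phi s a * psi t d * psi s b.
    by rewrite -!mulrA [psi s b * _]psiC !mulrA [phi s a * _]phiC.
  by rewrite opprB addrA subrK.
have -> : w a b * w c d - w c d * w a b =
    ((b == c)%:R : R) *: w a d - ((d == a)%:R : R) *: w c b.
  have dsum (e : bool) (g h : 'I_m -> A) :
      \sum_s \sum_t (((s == t) && e)%:R : R) *: (g s * h t) =
      (e%:R : R) *: \sum_s g s * h s.
    rewrite scaler_sumr; apply: eq_bigr => s _.
    rewrite (bigD1 s) //= eqxx big1 ?addr0 // => t /negPf ts.
    by rewrite eq_sym ts scale0r.
  rewrite -(dsum _ (phi^~ a)) -(dsum _ (phi^~ c)) [X in _ = _ - X]exchange_big.
  rewrite /w !mulr_suml [X in _ - X = _](_ : _ = \sum_s \sum_t phi t c * psi t d * (phi s a * psi s b)).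
    rewrite -!sumrB; apply: eq_bigr => s _; rewrite mulr_sumr -!sumrB.
    by apply: eq_bigr => t _; rewrite comm.
  by rewrite [RHS]exchange_big; apply: eq_bigr => t _; rewrite mulr_sumr.
rewrite !scalerDr !scalerA opprD addrACA.
rewrite [X in _ = _ + X](_ : _ = 0) ?addr0 // -scalerBl.
rewrite [X in X *: _](_ : _ = 0) ?scale0r //.
by rewrite [d == a]eq_sym [c == b]eq_sym; ring.
Qed.

Lemma rep_pair (L1 L2 : lieAlgType R) (f1 : L1 -> A) (f2 : L2 -> A) :
  lie_rep f1 -> lie_rep f2 -> (forall x y, f1 x * f2 y = f2 y * f1 x) ->
  lie_rep (fun z : (L1 * L2)%type => f1 z.1 + f2 z.2).
Proof.
move=> [l1 b1] [l2 b2] C; split=> [a x y|x y] /=.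
  by rewrite l1 l2 scalerDr addrACA.
have cancel (V : zmodType) (a v w z g h : V) :
    a - v + (w - z) = a + g + (h + w) - (v + h + (g + z)).
  rewrite (addrACA a g) (opprD (v + h)) (addrACA (a + h)).
  by rewrite (opprD v) (addrACA a h) subrr addr0 (opprD g) (addrACA g) subrr add0r.
by rewrite b1 b2 !mulrDl !mulrDr -(C y.1) -(C x.1); apply: cancel.
Qed.

End GlExt.

Section Weil.
Variables (F : numClosedFieldType) (m p q : nat).

Definition lie_g : lieAlgType F := ('M[F]_m * 'M[F]_m)%type.
Definition lie_m : lieAlgType F := 'M[F]_(p + q).
Notation Ug := (uea lie_g).
Notation Um := (uea lie_m).

Definition PDV := diffop F (m * p + m * q).

Definition xvar (s : 'I_m) (i : 'I_p) : 'I_(m * p + m * q) :=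
  lshift (m * q) (mxvec_index s i).
Definition yvar (s : 'I_m) (i : 'I_q) : 'I_(m * p + m * q) :=
  rshift (m * p) (mxvec_index s i).

Definition Xmx : 'M[PDV]_(m, p) := \matrix_(s, i) do_var F (xvar s i).
Definition Ymx : 'M[PDV]_(m, q) := \matrix_(s, i) do_var F (yvar s i).
Definition dX : 'M[PDV]_(m, p) := \matrix_(s, i) do_deriv F (xvar s i).
Definition dY : 'M[PDV]_(m, q) := \matrix_(s, i) do_deriv F (yvar s i).

Definition Pmx : 'M[PDV]_(m, p + q) := row_mx Xmx dY.
Definition Qmx : 'M[PDV]_(m, p + q) := row_mx dX Ymx.

(** The values of omega on [(E_{s,t}, 0)], on [(0, E_{s,t})] and on the matrix
    units [E_{a,b}] of [gl_{p+q}]; see [omega_gEX], [omega_gEY], [omega_mE]. *)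
Definition weilX : 'M[PDV]_m := \matrix_(s, t)
  (\sum_(i < p) Xmx s i * dX t i + (p%:R / 2 * (s == t)%:R : F)%:A).
Definition weilY : 'M[PDV]_m := \matrix_(s, t)
  (\sum_(i < q) Ymx s i * dY t i + (q%:R / 2 * (s == t)%:R : F)%:A).
Definition weilM : 'M[PDV]_(p + q) := block_mx
  (\matrix_(i, j)
     (\sum_(s < m) Xmx s i * dX s j + (m%:R / 2 * (i == j)%:R : F)%:A))
  (\matrix_(i, j) ('i *: \sum_(s < m) Xmx s i * Ymx s j))
  (\matrix_(j, i) ('i *: \sum_(s < m) dX s i * dY s j))
  (\matrix_(i, j)
     (- (\sum_(s < m) Ymx s j * dY s i) - (m%:R / 2 * (i == j)%:R : F)%:A)).

Lemma mxvec_index_eq n (s t : 'I_m) (i j : 'I_n) :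
  (mxvec_index s i == mxvec_index t j) = (s == t) && (i == j).
Proof.
by rewrite (inj_eq (@cast_ord_inj _ _ _)) (inj_eq enum_rank_inj) xpair_eqE.
Qed.
Lemma xvar_eq s i t j : (xvar s i == xvar t j) = (s == t) && (i == j).
Proof. by rewrite (inj_eq (@lshift_inj _ _)) mxvec_index_eq. Qed.
Lemma yvar_eq s i t j : (yvar s i == yvar t j) = (s == t) && (i == j).
Proof. by rewrite (inj_eq (@rshift_inj _ _)) mxvec_index_eq. Qed.
Lemma xyvar_eq s i t j : (xvar s i == yvar t j) = false.
Proof. exact: eq_lrshift. Qed.

Lemma Xmx_Xmx s i t j : Xmx s i * Xmx t j = Xmx t j * Xmx s i.
Proof. by rewrite !mxE do_varC. Qed.
Lemma Ymx_Ymx s i t j : Ymx s i * Ymx t j = Ymx t j * Ymx s i.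
Proof. by rewrite !mxE do_varC. Qed.
Lemma Xmx_Ymx s i t j : Xmx s i * Ymx t j = Ymx t j * Xmx s i.
Proof. by rewrite !mxE do_varC. Qed.
Lemma dX_dX s i t j : dX s i * dX t j = dX t j * dX s i.
Proof. by rewrite !mxE do_derivC. Qed.
Lemma dY_dY s i t j : dY s i * dY t j = dY t j * dY s i.
Proof. by rewrite !mxE do_derivC. Qed.
Lemma dX_dY s i t j : dX s i * dY t j = dY t j * dX s i.
Proof. by rewrite !mxE do_derivC. Qed.
Lemma dX_X s i t j : dX s i * Xmx t j - Xmx t j * dX s i =
  (((s == t) && (i == j))%:R : F)%:A.
Proof. by rewrite !mxE do_deriv_var xvar_eq. Qed.
Lemma dY_Y s i t j : dY s i * Ymx t j - Ymx t j * dY s i =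
  (((s == t) && (i == j))%:R : F)%:A.
Proof. by rewrite !mxE do_deriv_var yvar_eq. Qed.
Lemma dX_Y s i t j : dX s i * Ymx t j = Ymx t j * dX s i.
Proof.
by apply/eqP; rewrite -subr_eq0 !mxE do_deriv_var xyvar_eq scale0r.
Qed.
Lemma dY_X s i t j : dY s i * Xmx t j = Xmx t j * dY s i.
Proof.
by apply/eqP; rewrite -subr_eq0 !mxE do_deriv_var [yvar _ _ == _]eq_sym xyvar_eq scale0r.
Qed.

Lemma weilX_rep : lie_rep (gl_ext weilX).
Proof.
apply: (ccr_rep (phi := fun i s => Xmx s i) (psi := fun i s => dX s i)).
- by move=> *; exact: Xmx_Xmx.
- by move=> *; exact: dX_dX.
- by move=> i j s t; rewrite dX_X andbC.
Qed.

Lemma weilY_rep : lie_rep (gl_ext weilY).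
Proof.
apply: (ccr_rep (phi := fun i s => Ymx s i) (psi := fun i s => dY s i)).
- by move=> *; exact: Ymx_Ymx.
- by move=> *; exact: dY_dY.
- by move=> i j s t; rewrite dY_Y andbC.
Qed.

Lemma weilXY_comm s t s' t' : weilX s t * weilY s' t' = weilY s' t' * weilX s t.
Proof.
apply/eqP; rewrite -subr_eq0 [weilX s t]mxE [weilY s' t']mxE br_cst subr_eq0; apply/eqP.
rewrite mulr_suml mulr_sumr; apply: eq_bigr => i _.
rewrite mulr_suml mulr_sumr; apply: eq_bigr => j _.
rewrite -mulrA (mulrA (dX _ _)) dX_Y -mulrA dX_dY (mulrA (Xmx _ _)) Xmx_Ymx.
by rewrite -!mulrA (mulrA (dY _ _) (Xmx _ _)) dY_X -mulrA.
Qed.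

Lemma weil_g_rep :
  lie_rep (fun z : lie_g => gl_ext weilX z.1 + gl_ext weilY z.2).
Proof.
apply: rep_pair weilX_rep weilY_rep _ => x y.
exact: gl_ext_comm weilXY_comm.
Qed.

(** In the variables [phi = (X, i dY)] and [psi = (dX, i Y)], which satisfy the
    canonical commutation relations, the formulas of [weilM] read uniformly
    [sum_s phi_{s,a} psi_{s,b} + m/2 delta_{a,b}]. *)
Definition wphi : 'M[PDV]_(m, p + q) := row_mx Xmx (map_mx ( *:%R 'i) dY).
Definition wpsi : 'M[PDV]_(m, p + q) := row_mx dX (map_mx ( *:%R 'i) Ymx).

Lemma weilM_ccr : weilM = \matrix_(a, b)
  (\sum_s wphi s a * wpsi s b + (m%:R / 2 * (a == b)%:R : F)%:A).
Proof.
have ii (u v : PDV) : ('i *: u) * ('i *: v) = - (u * v).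
  by rewrite -scalerAl -scalerAr scalerA -expr2 sqrCi scaleN1r.
rewrite -[RHS]submxK; congr block_mx; apply/matrixP => a b; rewrite 4!mxE.
- rewrite (inj_eq (@lshift_inj _ _)); congr (_ + _).
  by apply: eq_bigr => s _; rewrite !row_mxEl.
- rewrite eq_lrshift mulr0 scale0r addr0 scaler_sumr; apply: eq_bigr => s _.
  by rewrite row_mxEl row_mxEr [map_mx _ _ _ _]mxE scalerAr.
- rewrite eq_rlshift mulr0 scale0r addr0 scaler_sumr; apply: eq_bigr => s _.
  by rewrite row_mxEl row_mxEr [map_mx _ _ _ _]mxE dX_dY scalerAl.
rewrite (inj_eq (@rshift_inj _ _)).
transitivity (\sum_(s < m) - (dY s a * Ymx s b) +
              (m%:R / 2 * (a == b)%:R : F)%:A); last first.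
  congr (_ + _); apply: eq_bigr => s _.
  by rewrite !row_mxEr ![map_mx _ _ _ _]mxE ii.
have dYY s : dY s a * Ymx s b = Ymx s b * dY s a + ((a == b)%:R : F)%:A.
  by apply/eqP; rewrite -subr_eq0 opprD addrA dY_Y eqxx subrr.
under [X in _ = X + _]eq_bigr do rewrite dYY opprD.
rewrite big_split /= sumrN -addrA; congr (_ + _).
rewrite sumr_const card_ord -!scaleNr scalerMnl -scalerDl.
congr (_ *: _); rewrite mulNrn -mulr_natl; by field.
Qed.

Lemma weil_m_rep : lie_rep (gl_ext weilM : lie_m -> PDV).
Proof.
rewrite weilM_ccr.
have sc (u v : PDV) : u * v = v * u -> u * ('i *: v) = ('i *: v) * u.
  by move=> uv; rewrite -scalerAl -scalerAr uv.
apply: (ccr_rep (phi := fun s a => wphi s a) (psi := fun s a => wpsi s a)).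
- move=> s t a b; rewrite /wphi.
  case: (split_ordP a) => {}a ->; case: (split_ordP b) => {}b ->;
    rewrite ?row_mxEl ?row_mxEr ?[map_mx _ _ _ _]mxE.
  + exact: Xmx_Xmx.
  + by apply: sc; rewrite dY_X.
  + by apply/esym/sc; rewrite dY_X.
  + by rewrite -!scalerAl -!scalerAr dY_dY.
- move=> s t a b; rewrite /wpsi.
  case: (split_ordP a) => {}a ->; case: (split_ordP b) => {}b ->;
    rewrite ?row_mxEl ?row_mxEr ?[map_mx _ _ _ _]mxE.
  + exact: dX_dX.
  + by apply: sc; rewrite dX_Y.
  + by apply/esym/sc; rewrite dX_Y.
  + by rewrite -!scalerAl -!scalerAr Ymx_Ymx.
move=> s t a b; rewrite /wphi /wpsi.
case: (split_ordP a) => {}a ->; case: (split_ordP b) => {}b ->;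
  rewrite ?row_mxEl ?row_mxEr ?[map_mx _ _ _ _]mxE.
- by rewrite dX_X (inj_eq (@lshift_inj _ _)).
- by rewrite eq_lrshift andbF scale0r sc ?dX_dY // subrr.
- by rewrite eq_rlshift andbF scale0r -sc ?subrr // Xmx_Ymx.
rewrite (inj_eq (@rshift_inj _ _)) -!scalerAl -!scalerAr !scalerA -expr2 sqrCi.
rewrite !scaleN1r opprK addrC.
by rewrite -(eq_sym t) -(eq_sym b) -dY_Y.
Qed.

Definition omega_g : {lrmorphism Ug -> PDV} := uea_lift weil_g_rep.
Definition omega_m : {lrmorphism Um -> PDV} := uea_lift weil_m_rep.

Lemma omega_gEX s t : omega_g (uea_iota (delta_mx s t, 0)) = weilX s t.
Proof.
by rewrite [LHS](uea_lift_iota weil_g_rep) /= gl_ext_delta /gl_ext !big1 ?addr0 // => *;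
   rewrite big1 // => *; rewrite mxE scale0r.
Qed.
Lemma omega_gEY s t : omega_g (uea_iota (0, delta_mx s t)) = weilY s t.
Proof.
by rewrite [LHS](uea_lift_iota weil_g_rep) /= gl_ext_delta /gl_ext !big1 ?add0r // => *;
   rewrite big1 // => *; rewrite mxE scale0r.
Qed.
Lemma omega_mE a b : omega_m (uea_iota (delta_mx a b)) = weilM a b.
Proof. by rewrite [LHS](uea_lift_iota weil_m_rep) gl_ext_delta. Qed.

Definition Ad_gl n (g : 'M[F]_n) (M : 'M[F]_n) : 'M[F]_n := g *m M *m invmx g.

Lemma Ad_gl_hom n (g : 'M[F]_n) : g \in unitmx -> lie_hom (Ad_gl g).
Proof.
move=> gu; split=> [a M N|M N].
  by rewrite /Ad_gl mulmxDr mulmxDl -scalemxAr -scalemxAl.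
have AdM (A B : 'M[F]_n) : Ad_gl g (A *m B) = Ad_gl g A *m Ad_gl g B.
  by rewrite /Ad_gl !mulmxA mulmxKV.
rewrite [RHS]/(Ad_gl g M *m Ad_gl g N - Ad_gl g N *m Ad_gl g M) -!AdM.
have AdB (A B : 'M[F]_n) : Ad_gl g (A - B) = Ad_gl g A - Ad_gl g B.
  by rewrite /Ad_gl mulmxBr mulmxBl.
exact: AdB.
Qed.

(** [GL_m] is embedded into [GL_m * GL_m] by [k |-> (k, transpose k^-1)], with
    Lie algebra [{(A, - A^T)}]. *)
Definition Ad_K (k : 'M[F]_m) (z : lie_g) : lie_g :=
  (Ad_gl k z.1, Ad_gl (invmx k)^T z.2).

Lemma Ad_K_hom k : k \in unitmx -> lie_hom (Ad_K k).
Proof.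
move=> ku; have [l1 b1] := Ad_gl_hom ku.
have [l2 b2] : lie_hom (Ad_gl (invmx k)^T).
  by apply: Ad_gl_hom; rewrite unitmx_tr unitmx_inv.
by split=> [a x y|x y]; congr pair; rewrite ?l1 ?l2 ?b1 ?b2.
Qed.

Definition Ad_H (h1 : 'M[F]_p) (h2 : 'M[F]_q) : lie_m -> lie_m :=
  Ad_gl (block_mx h1 0 0 h2).

Lemma Ad_H_hom h1 h2 : h1 \in unitmx -> h2 \in unitmx -> lie_hom (Ad_H h1 h2).
Proof.
move=> h1u h2u; apply: Ad_gl_hom.
by rewrite unitmxE det_ublock unitrM -!unitmxE h1u h2u.
Qed.

Definition K_invariant (u : Ug) : Prop :=
  forall k (hk : k \in unitmx), uea_map (Ad_K_hom hk) u = u.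
Definition H_invariant (u : Um) : Prop :=
  forall h1 h2 (h1u : h1 \in unitmx) (h2u : h2 \in unitmx),
    uea_map (Ad_H_hom h1u h2u) u = u.

End Weil.

Definition idx (n d : nat) : Type := {S : {set 'I_n} | #|S| == d}.

(** The elements of [S], in increasing order (see [elt_mono]). *)
Definition elt n d (S : idx n d) (k : 'I_d) : 'I_n :=
  enum_val (cast_ord (esym (eqP (valP S))) k).

Lemma elt_mono n d (S : idx n d) : {homo elt S : i j / (i < j)%N}.
Proof.
move=> i j ij; rewrite /elt /enum_val.
set x0 := enum_default _; rewrite (set_nth_default x0 (enum_default _)) -?cardE //.
have srt : sorted (relpre val ltn) (enum (val S)).
  rewrite /enum_mem; apply: sorted_filter => [x y z /=|]; first exact: ltn_trans.
  by rewrite -enumT -sorted_map val_enum_ord iota_ltn_sorted.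
apply: (sorted_ltn_nth _ x0 srt) => //=; rewrite ?inE -?cardE ?(eqP (valP S)) //.
  by move=> x y z /=; exact: ltn_trans.
Qed.

Lemma elt_in n d (S : idx n d) k : elt S k \in val S.
Proof. exact: enum_valP. Qed.

Definition minor_mx (T : Type) n n' d (S : idx n d) (J : idx n' d)
  (A : 'M[T]_(n, n')) : 'M[T]_d := mxsub (elt S) (elt J) A.

Section Det.
Variables (F : fieldType) (U : algType F).

Definition symdet n (A : 'M[U]_n) : U :=
  (n`!%:R : F)^-1 *: \sum_(s : 'S_n) \sum_(t : 'S_n)
    ((-1) ^+ s * (-1) ^+ t : F) *: \prod_(k < n) A (s k) (t k).

Definition I_pq p q : 'M[F]_(p + q) := block_mx 1%:M 0 0 (- 1%:M).

Definition symdet_pq p q l (B : 'M[U]_(p + q)) (I J : idx (p + q) l)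
    (u : 'I_l -> F) : U :=
  let eps := - I_pq p q in
  (l`!%:R : F)^-1 *: \sum_(s : 'S_l) \sum_(t : 'S_l)
    ((-1) ^+ s * (-1) ^+ t : F) *:
      \prod_(k < l) (B (elt I (s k)) (elt J (t k))
                     - (u k * eps (elt I (s k)) (elt J (t k)))%:A).
End Det.

(** The sum over [k] is over the support [0 <= k <= a + b] of the binomial. *)
Definition coef_ab (d a b : nat) : int :=
  \sum_(0 <= k < (a + b).+1) 'C(a + b, k)%:Z * (b%:Z - k%:Z) ^+ d * (-1) ^+ k.

Definition coef (p q d l : nat) (J : idx (p + q) l) : int :=
  coef_ab d #|[set i : 'I_l | (elt J i < p)%N]|
            #|[set i : 'I_l | (p <= elt J i)%N]|.

Section Elements.
Variables (F : numClosedFieldType) (m p q : nat).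

Definition EX : 'M[uea (lie_g F m)]_m :=
  \matrix_(s, t) uea_iota ((delta_mx s t, 0) : lie_g F m).
Definition EY : 'M[uea (lie_g F m)]_m :=
  \matrix_(s, t) uea_iota ((0, delta_mx s t) : lie_g F m).

Definition X_elt (d : nat) : uea (lie_g F m) :=
  \sum_(S : idx m d)
    symdet (minor_mx S S (EX + EY^T - ((p%:R - q%:R) / 2 : F)%:A%:M)).

Definition emb_mx (U : algType F) n (A : 'M[F]_n) : 'M[U]_n :=
  map_mx (fun c => c%:A) A.

Definition B'mx : 'M[uea (lie_m F p q)]_(p + q) :=
  \matrix_(i, j) uea_iota (delta_mx i j : lie_m F p q).
Definition Dmx : 'M[F]_(p + q) := block_mx 1%:M 0 0 (- 'i)%:M.
Definition Bmx : 'M[uea (lie_m F p q)]_(p + q) :=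
  emb_mx _ Dmx *m B'mx *m emb_mx _ Dmx.

Definition coef_fact (d l : nat) : F :=
  (m - l)`!%:R / (d`!%:R * (m - d)`!%:R).

Definition C_elt (d : nat) : uea (lie_m F p q) :=
  \sum_(0 <= l < d.+1) coef_fact d l *: \sum_(J : idx (p + q) l)
    (coef d J)%:~R *:
      symdet_pq (Bmx - emb_mx _ ((m%:R / 2) *: I_pq F p q)) J J
        (fun k : 'I_l => (l.-1 - k)%:R).

Definition weil_image (d : nat) : PDV F m p q :=
  \sum_(0 <= l < d.+1) coef_fact d l *: \sum_(J : idx (p + q) l)
    (coef d J)%:~R *: \sum_(S : idx m l)
      \det (minor_mx S J (Pmx F m p q)) * \det (minor_mx S J (Qmx F m p q)).

End Elements.

(* Main.v *)
From HB Require Import structures.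
Require Import Defs.
From mathcomp Require Import all_boot all_order all_algebra.
From mathcomp Require Import fingroup perm reals complex ring zify.

Set Implicit Arguments.
Unset Strict Implicit.
Unset Printing Implicit Defensive.

Import Order.TTheory GRing.Theory Num.Theory.
Local Open Scope ring_scope.

(** Put [P = (X, dY)] and [Q = (dX, Y)].  The entries of [P] commute, so do those
    of [Q], and the commutator of [Q t b] with [P s a] is [block_sign a] if
    [(s, a) = (t, b)] and zero otherwise, where [block_sign a] is [1] on the first
    [p] columns and [-1] on the last [q].  After the normalizing shifts, the matrix
    that defines [X_elt] is sent by [omega_g] to [P Q^T] (lemma [omega_X]), and the
    one that defines [C_elt] is sent by [omega_m] to [P^T Q], up to the diagonal
    shift (lemma [omega_B]).  Everything then follows from these relations.

    Symmetrized minors are coefficients in an exterior algebra.  Take two sets of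
    generators [e_s] and [e'_t], each anticommuting within itself, the two commuting
    with each other and with the entries.  Then the coefficient of [e_S e'_T] in the
    [d]-th power of [\sum_(s, t) e_s e'_t M_st] is [d!] times the symmetrized
    determinant of the minor [(S, T)] of [M] (lemma [gbil_prod_coef]), whether or
    not the entries of [M] commute.  This is realized by an exterior algebra with
    coefficients in another one.

    For [P Q^T], let [alpha a = \sum_s e_s P_sa], [beta a = \sum_t e'_t Q_ta] and
    [theta = \sum_s e_s e'_s].  The products [x a = alpha a * beta a] commute with
    each other and with [theta], and [x a ^ 2 = - block_sign a * theta * x a].
    The powers of [\sum_a x a] are therefore explicit: the coefficient of
    [theta ^ (d - #|J|) * \prod_(a in J) x a] is the integer [coef]
    ([sum_commuting_exp]).  The product over [J] splits into minors of [P] and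
    minors of [Q], and taking the trace over principal minors replaces each factor
    [theta] by an integer, which produces the quotient of factorials
    ([sum_principal_altsum]).

    For [P^T Q], generators are attached to columns instead.  With
    [pi s = \sum_a e_a P_sa], [kappa s = \sum_b e'_b Q_sb],
    [omega = \sum_s pi s * kappa s] and [theta = \sum_a block_sign a * e_a e'_a],
    one has [(omega + theta) * pi s = - pi s * omega], so that the product of the
    [omega + (l - k) theta], for [1 <= k <= l], is the sum over all [l]-tuples [g]
    of [\prod_k pi (g k) * \prod_k kappa (g k)].  Its coefficients are sums of
    products of a minor of [P] and a minor of [Q] ([capelli_altsum]).

    The two invariances are formal: a group element acts on the matrix of
    generators by a conjugation with scalar entries, and sums of symmetrized
    principal minors are combinations of traces, insensitive to it, even when they
    are weighted by a function that is constant on each block of the conjugating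
    matrix ([sum_altsum_conj]). *)

(** * Subsets, tuples and products of commuting or anticommuting factors *)

Section Subsets.
Variables (n d : nat).

Lemma sum_idx (V : nmodType) (h : {set 'I_n} -> V) :
  \sum_(S : idx n d) h (val S) = \sum_(S : {set 'I_n} | #|S| == d) h S.
Proof. exact/esym/(big_sub [pred S : {set 'I_n} | #|S| == d]). Qed.

Definition elt_perm (S : idx n d) (s : 'S_d) : {ffun 'I_d -> 'I_n} :=
  [ffun k => elt S (s k)].

Lemma elt_inj (S : idx n d) : injective (elt S).
Proof. by move=> i j /enum_val_inj/cast_ord_inj. Qed.

Lemma elt_perm_inj (S : idx n d) : injective (elt_perm S).
Proof.
move=> s t /ffunP st; apply/permP => k.
by have := st k; rewrite !ffunE => /elt_inj.
Qed.

Lemma elt_permK (S : idx n d) (s : 'S_d) : [set elt_perm S s k | k : 'I_d] = val S.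
Proof.
apply/eqP; rewrite eqEcard (eqP (valP S)); apply/andP; split.
  by apply/subsetP => _ /imsetP[k _ ->]; rewrite ffunE elt_in.
rewrite card_imset ?card_ord // => i j.
by rewrite !ffunE => /elt_inj/perm_inj.
Qed.

Lemma elt_perm_onto (S : idx n d) (f : {ffun 'I_d -> 'I_n}) :
  injective f -> [set f k | k : 'I_d] = val S -> exists s, f = elt_perm S s.
Proof.
move=> f_inj fS.
have fP k : f k \in val S by rewrite -fS imset_f.
pose g k : 'I_d := cast_ord (eqP (valP S)) (enum_rank_in (fP k) (f k)).
have gE k : elt S (g k) = f k by rewrite /elt cast_ordK enum_rankK_in.
have g_inj : injective g by move=> i j ij; apply: f_inj; rewrite -!gE ij.
by exists (perm g_inj); apply/ffunP => k; rewrite ffunE permE gE.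
Qed.

(** Minors are indexed by subsets, but expressions that are alternating in
    their indices are easier to manipulate as sums over all tuples: those with a
    repeated index contribute nothing, and an injective tuple is an increasing
    one followed by a permutation. *)
Lemma sum_ffun_idx (V : nmodType) (h : {ffun 'I_d -> 'I_n} -> V) :
  (forall f : {ffun 'I_d -> 'I_n}, ~~ injectiveb f -> h f = 0) ->
  \sum_(f : {ffun 'I_d -> 'I_n}) h f = \sum_(S : idx n d) \sum_(s : 'S_d) h (elt_perm S s).
Proof.
move=> h0; rewrite (bigID (fun f : {ffun _} => injectiveb f)) /=.
rewrite [X in _ + X]big1 // addr0.
pose im (f : {ffun 'I_d -> 'I_n}) := [set f k | k : 'I_d].
have im_card (f : {ffun _}) : injectiveb f -> #|im f| == d.
  by move/injectiveP => fi; rewrite card_imset // card_ord.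
rewrite (partition_big im (fun S => #|S| == d)) //=.
rewrite -sum_idx; apply: eq_bigr => S _.
transitivity (\sum_(f in [set elt_perm S s | s in [set: 'S_d]]) h f).
  apply: eq_bigl => f; apply/andP/imsetP => [[/injectiveP fi /eqP fS]|[s _ ->]].
    by have [s ->] := elt_perm_onto fi fS; exists s; rewrite ?inE.
  rewrite [im _]elt_permK; split=> //; apply/injectiveP => i j.
  by rewrite !ffunE => /elt_inj/perm_inj.
rewrite big_imset /=; last exact: in2W (@elt_perm_inj S).
by apply: eq_bigl => s; rewrite inE.
Qed.

End Subsets.

Lemma sum_set_card n d (V : nmodType) (h : {set 'I_n} -> V) :
  (forall S : {set 'I_n}, (d < #|S|)%N -> h S = 0) ->
  \sum_(S : {set 'I_n}) h S = \sum_(0 <= l < d.+1) \sum_(S : idx n l) h (val S).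
Proof.
move=> h0; under [RHS]eq_bigr do rewrite sum_idx.
rewrite big_mkord (exchange_big_dep xpredT) //=; apply: eq_bigr => S _.
have [dS|Sd] := ltnP d #|S|; first by rewrite h0 // big1.
by rewrite (big_pred1 (Ordinal (Sd : #|S| < d.+1)%N)).
Qed.

Section SetSums.
Variables (I : finType) (V : nmodType).

Lemma sum_setD1 (P : pred nat) (F : I -> {set I} -> V) :
  \sum_(S : {set I} | P #|S|) \sum_(i in S) F i (S :\ i) =
  \sum_(S : {set I} | P #|S|.+1) \sum_(i | i \notin S) F i S.
Proof.
rewrite (exchange_big_dep xpredT) //= [RHS](exchange_big_dep xpredT) //=.
apply: eq_bigr => i _.
rewrite (reindex_onto (fun S => i |: S) (fun S => S :\ i)) /=; last first.
  by move=> S /andP[_ iS]; rewrite setD1K.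
apply: eq_big => [S|S /andP[_ /eqP ->]] //.
have [iS|iS] := boolP (i \in S); last first.
  by rewrite setU11 setU1K // cardsU1 iS eqxx !andbT.
rewrite /= andbF; apply/negbTE/negP => /andP[_ /eqP/setP/(_ i)].
by rewrite !inE eqxx iS.
Qed.

End SetSums.

Section CommutingProducts.
Variable A : pzRingType.

Lemma perm_prod_comm (I : eqType) (F : I -> A) (s t : seq I) :
  (forall i j, F i * F j = F j * F i) -> perm_eq s t ->
  \prod_(i <- s) F i = \prod_(i <- t) F i.
Proof.
move=> FC; move: s t.
apply: (catCA_perm_subst (F := fun u => \prod_(i <- u) F i)) => s1 s2 s3.
rewrite !big_cat /= !mulrA; congr (_ * _).
by apply: commr_prod => i _; apply/commr_sym/commr_prod => j _; apply: FC.
Qed.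

Lemma prod_perm_comm d (F : 'I_d -> A) (s : 'S_d) :
  (forall i j, F i * F j = F j * F i) -> \prod_k F (s k) = \prod_k F k.
Proof.
move=> FC; rewrite -(big_map s xpredT F); apply: perm_prod_comm => //.
apply: uniq_perm => [||k]; rewrite ?index_enum_uniq //.
  by rewrite map_inj_uniq ?index_enum_uniq //; apply: perm_inj.
by rewrite mem_index_enum -[k](permKV s) mem_map ?mem_index_enum //; apply: perm_inj.
Qed.

Lemma prod_setU1_comm (I : finType) (F : I -> A) (S : {set I}) i :
  (forall i j, F i * F j = F j * F i) -> i \notin S ->
  \prod_(j in i |: S) F j = F i * \prod_(j in S) F j.
Proof.
move=> FC iS.
transitivity (\prod_(j <- i :: [seq j <- index_enum I | j \in S]) F j); last first.
  by rewrite big_cons big_filter.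
rewrite -big_filter; apply: perm_prod_comm => //; apply: uniq_perm => [||k].
- by rewrite filter_uniq ?index_enum_uniq.
- by rewrite /= mem_filter (negbTE iS) filter_uniq ?index_enum_uniq.
by rewrite inE !mem_filter !mem_index_enum !andbT !inE.
Qed.

Lemma prod_anti_swap (I : eqType) (x : A) (F : I -> A) s :
  (forall i, x * F i = - (F i * x)) ->
  x * \prod_(i <- s) F i = (-1) ^+ size s * (\prod_(i <- s) F i * x).
Proof.
move=> xF; elim: s => [|i s IH]; first by rewrite big_nil mulr1 !mul1r.
rewrite big_cons mulrA xF mulNr -mulrA IH [size _]/= exprS mulN1r mulNr; congr (- _).
by rewrite [LHS]mulrA (commr_sign (F i) _ : _ = _) -!mulrA.
Qed.

(** The two factors at [i] and [j] are isolated at the same time in the product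
    and in its transposed version; the block [w] between them only matters
    through the sign that a factor picks up in crossing it. *)
Lemma prod_split2 d (F : 'I_d -> A) (i j : 'I_d) :
  (forall i j, F i * F j = - (F j * F i)) -> (i < j)%N ->
  exists u w v : A, exists n, [/\ \prod_k F k = u * (F i * (w * F j)) * v,
    \prod_k F (tperm i j k) = u * (F j * (w * F i)) * v &
    forall k, F k * w = (-1) ^+ n * (w * F k)].
Proof.
case: d => [|d] in F i j * => FA ij; first by have := ltn_ord i.
pose G (s : 'S_d.+1) a b := \prod_(a <= k < b) F (s (inord k)).
have GE (s : 'S_d.+1) :
    \prod_k F (s k) = G s 0 i * (F (s i) * (G s i.+1 j * F (s j))) * G s j.+1 d.+1.
  transitivity (G s 0 d.+1).
    by rewrite /G big_mkord; apply: eq_bigr => k _; rewrite inord_val.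
  rewrite /G (big_cat_nat (n := i)) ?(ltnW (ltn_ord i)) //= -mulrA.
  rewrite [in LHS](big_ltn (ltn_ord i)) inord_val; congr (_ * _).
  rewrite (big_cat_nat (n := j)) ?(ltnW (ltn_ord j)) //= -!mulrA.
  by rewrite [in LHS](big_ltn (ltn_ord j)) inord_val.
have Gt a b : (forall k, (a <= k < b)%N -> (k != i) && (k != j) && (k < d.+1)%N) ->
    G (tperm i j) a b = G 1%g a b.
  move=> ab; apply: eq_big_nat => k /ab /andP[/andP[ki kj] kd].
  by rewrite perm1 tpermD //; rewrite -val_eqE /= inordK // eq_sym.
have [lti ltj] := (ltn_ord i, ltn_ord j).
exists (G 1%g 0 i), (G 1%g i.+1 j), (G 1%g j.+1 d.+1), (size (index_iota i.+1 j)).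
split=> [||k]; last by rewrite /G prod_anti_swap.
  by rewrite -[LHS](eq_bigr _ (fun k _ => congr1 F (perm1 k))) GE !perm1.
by rewrite GE tpermL tpermR !Gt => // k; lia.
Qed.

Lemma prod_anti_tperm d (F : 'I_d -> A) (i j : 'I_d) :
  (forall i j, F i * F j = - (F j * F i)) -> i != j ->
  \prod_k F (tperm i j k) = - \prod_k F k.
Proof.
move=> FA; wlog: i j / (i < j)%N => [wl ij|ij _].
  have [|ji|/val_inj /eqP] := ltngtP i j; first by move/wl; apply.
    by rewrite tpermC; apply: wl; rewrite // eq_sym.
  by rewrite (negbTE ij).
have [u [w [v [n [-> -> wF]]]]] := prod_split2 FA ij.
rewrite -mulNr -mulrN; congr (_ * _ * _).
by rewrite ![F _ * (w * _)]mulrA !wF -!mulrA FA !mulrN.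
Qed.

(** Adjacent factors may be interchanged at the price of a sign; moving one
    factor across a block and the other back shows that any transposition of
    two factors changes the sign too. *)
Lemma prod_anti_perm d (F : 'I_d -> A) (s : 'S_d) :
  (forall i j, F i * F j = - (F j * F i)) ->
  \prod_k F (s k) = (-1) ^+ s * \prod_k F k.
Proof.
have [ts -> /= dts] := prod_tpermP s; elim: ts => [|t ts IH] in F dts * => FA.
  by rewrite big_nil odd_perm1 mul1r; apply: eq_bigr => k _; rewrite perm1.
move: dts => /= /andP[td dts]; rewrite big_cons odd_mul_tperm td signr_addb mulN1r.
under eq_bigr do rewrite permM.
rewrite (@prod_anti_tperm _ (fun k => F ((\prod_(t <- ts) tperm t.1 t.2)%g k))) //.
by rewrite IH // mulNr.
Qed.

Lemma prod_anti_noninj (I : eqType) d (F : I -> A) (f : 'I_d -> I) :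
  (forall i j, F i * F j = - (F j * F i)) -> (forall i, F i * F i = 0) ->
  ~~ injectiveb f -> \prod_k F (f k) = 0.
Proof.
move=> FA F0 /injectivePn[i [j ij fij]].
wlog: i j ij fij / (i < j)%N => [wl|{ij}ij].
  have [|ji|/val_inj /eqP] := ltngtP i j; first exact: wl.
    by apply: (wl j i) => //; rewrite eq_sym.
  by rewrite (negbTE ij).
have [|u [w [v [n [-> _ wF]]]]] := @prod_split2 _ (F \o f) _ _ _ ij.
  by move=> *; apply: FA.
have -> : F (f i) * (w * F (f j)) = 0.
  by rewrite mulrA wF /= fij -!mulrA F0 !mulr0.
by rewrite mulr0 mul0r.
Qed.

End CommutingProducts.

(** * Exterior algebras over a noncommutative ring *)

Section Grassmann.
Variables (A : nzRingType) (n : nat).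
Notation set_n := {set 'I_n}.
Implicit Types (R S T U V : set_n) (a b : A) (i j : 'I_n).

(** The sign of the product of the monomials indexed by [T] and [U]: [0] if they
    share a variable, else [-1] to the number of inversions.  Written as a
    product over pairs it is visibly bimultiplicative, whence associativity. *)
Definition gsign T U : int :=
  \prod_(t in T) \prod_(u in U) Num.sg ((u : nat)%:Z - (t : nat)%:Z).

Lemma gsign0l U : gsign set0 U = 1.
Proof. by rewrite /gsign big_set0. Qed.

Lemma gsign0r T : gsign T set0 = 1.
Proof. by rewrite /gsign big1 // => t _; rewrite big_set0. Qed.

Lemma gsign_meet T U : ~~ [disjoint T & U] -> gsign T U = 0.
Proof.
move/pred0Pn => [i /andP[/= iT iU]].
by rewrite /gsign (bigD1 i) //= (bigD1 (i : 'I_n)) //= subrr sgr0 !mul0r.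
Qed.

Lemma prod_setU (F : 'I_n -> int) T U : [disjoint T & U] ->
  \prod_(i in T :|: U) F i = \prod_(i in T) F i * \prod_(i in U) F i.
Proof. by move=> TU; rewrite -bigU //; apply: eq_bigl => i; rewrite !inE. Qed.

Lemma gsignUl T U V :
  [disjoint T & U] -> gsign (T :|: U) V = gsign T V * gsign U V.
Proof. exact: prod_setU. Qed.

Lemma gsignUr T U V :
  [disjoint U & V] -> gsign T (U :|: V) = gsign T U * gsign T V.
Proof.
move=> UV; rewrite /gsign -big_split /=; apply: eq_bigr => t _.
exact: prod_setU.
Qed.

Lemma gsign_cocycle T U V :
  gsign T U * gsign (T :|: U) V = gsign U V * gsign T (U :|: V).
Proof.
have [TU|/gsign_meet TU] := boolP [disjoint T & U]; last first.
  rewrite TU mul0r; have [UV|/gsign_meet ->] := boolP [disjoint U & V].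
    by rewrite gsignUr // TU mul0r mulr0.
  by rewrite mul0r.
rewrite gsignUl //; have [UV|/gsign_meet ->] := boolP [disjoint U & V].
  by rewrite gsignUr //; ring.
by rewrite !(mulr0, mul0r).
Qed.

Lemma gsign1C i j : gsign [set i] [set j] = - gsign [set j] [set i].
Proof. by rewrite /gsign !big_set1 -sgrN opprB. Qed.

Lemma gsign1_sq i T : i \notin T -> gsign [set i] T * gsign [set i] T = 1.
Proof.
move=> iT; rewrite /gsign !big_set1 -big_split /= big1 // => t tT.
have: t != i by apply: contraNneq iT => <-.
by rewrite -val_eqE /= => ti; rewrite -expr2 sqr_sg subr_eq0 eqz_nat ti.
Qed.

(** The exterior algebra of the free module of rank [n], with coefficients in a
    possibly noncommutative ring that commutes with the generators: an element
    is the family of its coefficients on the increasing monomials. *)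
Definition grassmann := {ffun set_n -> A}.
HB.instance Definition _ := GRing.Zmodule.on grassmann.
Implicit Types x y z : grassmann.

Definition gmul : grassmann -> grassmann -> grassmann := locked (fun x y =>
  [ffun S => \sum_T \sum_(U | T :|: U == S) x T * y U *~ gsign T U]).

Definition gmon : set_n -> A -> grassmann := locked (fun T a =>
  [ffun S => if S == T then a else 0]).

Lemma gmulE x y S :
  gmul x y S = \sum_T \sum_(U | T :|: U == S) x T * y U *~ gsign T U.
Proof. by rewrite /gmul -lock ffunE. Qed.

Lemma gmonE T a S : gmon T a S = if S == T then a else 0.
Proof. by rewrite /gmon -lock ffunE. Qed.

Let gE := (gmulE, gmonE, ffunE).

Lemma sum_union (V : nmodType) (H : set_n -> set_n -> set_n -> V) :
  \sum_R \sum_T \sum_(U | T :|: U == R) H R T U =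
  \sum_T \sum_U H (T :|: U) T U.
Proof.
rewrite exchange_big; apply: eq_bigr => T _ /=.
rewrite (exchange_big_dep xpredT) //=; apply: eq_bigr => U _.
by under eq_bigl do rewrite eq_sym; rewrite big_pred1_eq.
Qed.

Lemma gmulA : associative gmul.
Proof.
move=> x y z; apply/ffunP => S; rewrite !gE.
transitivity (\sum_T \sum_U \sum_(V | T :|: U :|: V == S)
  x T * y U * z V *~ (gsign T U * gsign (T :|: U) V)); last first.
  rewrite -(sum_union (fun R T U => \sum_(V | R :|: V == S)
    x T * y U * z V *~ (gsign T U * gsign R V))).
  apply: eq_bigr => R _.
  under [RHS]eq_bigr => V _.
    rewrite gE mulr_suml mulrz_suml.
    under eq_bigr => T _ do rewrite mulr_suml mulrz_suml.
  over.
  rewrite [RHS]exchange_big /=; apply: eq_bigr => T _.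
  rewrite [RHS]exchange_big /=; apply: eq_bigr => U _; apply: eq_bigr => V _.
  by rewrite mulrzAl -mulrzA.
apply: eq_bigr => T _; rewrite big_mkcond /=.
transitivity (\sum_R \sum_U \sum_(V | U :|: V == R)
  if T :|: R == S then x T * y U * z V *~ (gsign U V * gsign T R) else 0).
  apply: eq_bigr => R _; case: ifP => _; last by rewrite big1 // => U _; rewrite big1.
  rewrite gE mulr_sumr mulrz_suml; apply: eq_bigr => U _.
  rewrite mulr_sumr mulrz_suml; apply: eq_bigr => V _.
  by rewrite mulrzAr mulrA -mulrzA.
rewrite (sum_union (fun R U V => if T :|: R == S then _ else 0)).
apply: eq_bigr => U _; rewrite [RHS]big_mkcond /=; apply: eq_bigr => V _.
by rewrite setUA gsign_cocycle.
Qed.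

Lemma gmon_mul T U a b :
  gmul (gmon T a) (gmon U b) = gmon (T :|: U) (a * b *~ gsign T U).
Proof.
apply/ffunP => S; rewrite !gE (bigD1 T) //= [X in _ + X]big1 ?addr0; last first.
  by move=> R /negPf RT; rewrite big1 // => V _; rewrite gE RT !(mul0r, mul0rz).
rewrite big_mkcond (bigD1 U) //= [X in _ + X]big1 ?addr0; last first.
  by move=> V /negPf VU; rewrite !gE VU mulr0 mul0rz if_same.
by rewrite !gE !eqxx [S == _]eq_sym.
Qed.

Lemma gmon_mull T a x S :
  gmul (gmon T a) x S = \sum_(U | T :|: U == S) a * x U *~ gsign T U.
Proof.
rewrite gE (bigD1 T) //= [X in _ + X]big1 ?addr0; last first.
  by move=> R /negPf RT; rewrite big1 // => V _; rewrite gE RT !(mul0r, mul0rz).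
by apply: eq_bigr => U _; rewrite gE eqxx.
Qed.

Lemma gcst_mull a x S : gmul (gmon set0 a) x S = a * x S.
Proof.
rewrite gmon_mull; under eq_bigl do rewrite set0U.
by rewrite big_pred1_eq gsign0l.
Qed.

Lemma gcst_mulr a x S : gmul x (gmon set0 a) S = x S * a.
Proof.
rewrite gE (bigD1 S) //= [X in _ + X]big1 ?addr0 => [|T TS].
  rewrite big_mkcond (bigD1 set0) //= setU0 eqxx gsign0r gE eqxx big1 ?addr0 //.
  by move=> U /negPf U0; rewrite gE U0 mulr0 mul0rz if_same.
rewrite big1 // => U /eqP TUS; rewrite gE; case: eqVneq => [U0|].
  by rewrite -TUS U0 setU0 eqxx in TS.
by rewrite mulr0 mul0rz.
Qed.

Lemma g1mul : left_id (gmon set0 1) gmul.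
Proof. by move=> x; apply/ffunP => S; rewrite gcst_mull mul1r. Qed.

Lemma gmul1 : right_id (gmon set0 1) gmul.
Proof. by move=> x; apply/ffunP => S; rewrite gcst_mulr mulr1. Qed.

Lemma gmulDl : left_distributive gmul +%R.
Proof.
move=> x y z; apply/ffunP => S; rewrite !gE -big_split; apply: eq_bigr => T _ /=.
by rewrite -big_split; apply: eq_bigr => U _; rewrite gE mulrDl mulrzDl.
Qed.

Lemma gmulDr : right_distributive gmul +%R.
Proof.
move=> z x y; apply/ffunP => S; rewrite !gE -big_split; apply: eq_bigr => T _ /=.
by rewrite -big_split; apply: eq_bigr => U _; rewrite gE mulrDr mulrzDl.
Qed.

Lemma gone_neq0 : gmon set0 1 != 0.
Proof. by apply/eqP => /ffunP/(_ set0)/eqP; rewrite !gE eqxx oner_eq0. Qed.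

HB.instance Definition _ := GRing.Zmodule_isNzRing.Build grassmann
  gmulA g1mul gmul1 gmulDl gmulDr gone_neq0.

Definition gcst a : grassmann := gmon set0 a.
Definition gen i : grassmann := gmon [set i] 1.

Lemma gcst_is_zmod : zmod_morphism gcst.
Proof. by move=> a b; apply/ffunP => S; rewrite !gE; case: eqP; rewrite ?subr0. Qed.

Lemma gcst_is_monoid : monoid_morphism gcst.
Proof.
by split=> // a b; rewrite /gcst [RHS]gmon_mul setU0 gsign0l.
Qed.

HB.instance Definition _ := GRing.isZmodMorphism.Build A grassmann gcst gcst_is_zmod.
HB.instance Definition _ := GRing.isMonoidMorphism.Build A grassmann gcst gcst_is_monoid.

Lemma gcstM a b : gcst (a * b) = gcst a * gcst b.
Proof. exact: rmorphM. Qed.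
Lemma gcstD a b : gcst (a + b) = gcst a + gcst b.
Proof. exact: rmorphD. Qed.
Lemma gcstN a : gcst (- a) = - gcst a.
Proof. exact: rmorphN. Qed.
Lemma gcstMz a k : gcst (a *~ k) = gcst a *~ k.
Proof. exact: rmorphMz. Qed.

Lemma gcstMl a x S : (gcst a * x) S = a * x S.
Proof. exact: gcst_mull. Qed.

Lemma gcstMr a x S : (x * gcst a) S = x S * a.
Proof. exact: gcst_mulr. Qed.

Lemma genMl i x S :
  (gen i * x) S = if i \in S then x (S :\ i) *~ gsign [set i] (S :\ i) else 0.
Proof.
rewrite [LHS]gmon_mull; case: ifP => iS; last first.
  by apply: big1 => U /eqP US; rewrite -US setU11 in iS.
rewrite (bigD1 (S :\ i)) ?setD1K //= mul1r big1 ?addr0 // => U /andP[/eqP US UnS].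
rewrite gsign_meet ?mulr0z // disjoints1; apply: contraNN UnS => iU.
by rewrite -US setU1K.
Qed.

Lemma gen_cst i a : gen i * gcst a = gcst a * gen i.
Proof. by rewrite [LHS]gmon_mul [RHS]gmon_mul setU0 set0U gsign0r gsign0l mulr1 mul1r. Qed.

Lemma gen_anti i j : gen i * gen j = - (gen j * gen i).
Proof.
rewrite [gen i * _]gmon_mul [gen j * _]gmon_mul gsign1C setUC.
by apply/ffunP => S; rewrite !gE mulrNz; case: eqP => _; rewrite ?oppr0.
Qed.

Lemma gen_sq i : gen i * gen i = 0.
Proof.
rewrite [LHS]gmon_mul gsign_meet ?disjoints1 ?inE ?eqxx //.
by apply/ffunP => S; rewrite !gE if_same.
Qed.

Lemma prod_gen_sorted (s : seq 'I_n) : sorted (relpre val ltn) s ->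
  \prod_(i <- s) gen i = gmon [set i in s] 1.
Proof.
elim: s => [|i s IH] /=; first by rewrite big_nil [1]/(gmon set0 1) set_nil.
move=> is_sorted; rewrite big_cons IH ?(path_sorted is_sorted) // [LHS]gmon_mul.
rewrite -set_cons mulr1 [gsign _ _](_ : _ = 1) //.
rewrite /gsign big_set1 big1 // => j; rewrite inE => js.
have /allP/(_ j js) /= ij : all (relpre val ltn i) s.
  by apply: order_path_min is_sorted => x y z; apply: ltn_trans.
by rewrite gtr0_sg // subr_gt0 ltz_nat.
Qed.

Lemma prod_gen_elt d (S T : idx n d) :
  (\prod_k gen (elt S k)) (val T) = (S == T)%:R.
Proof.
rewrite -(big_map (elt S) xpredT gen) prod_gen_sorted; last first.
  apply: (homo_sorted (e := relpre val ltn)) => [i j|]; first exact: elt_mono.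
  by rewrite -sorted_map /index_enum unlock -enumT val_enum_ord iota_ltn_sorted.
rewrite (_ : [set i in _] = val S); last first.
  apply/setP => i; rewrite inE -(elt_permK S 1).
  apply/mapP/imsetP => -[k _ ->]; exists k; rewrite ?mem_index_enum // ?gE ?perm1 //.
by rewrite gE (inj_eq val_inj) eq_sym; case: eqP.
Qed.

Lemma prod_gen_cst (I : Type) (r : seq I) (f : I -> 'I_n) (w : I -> A) :
  \prod_(k <- r) (gen (f k) * gcst (w k)) =
  \prod_(k <- r) gen (f k) * gcst (\prod_(k <- r) w k).
Proof.
elim: r => [|k r IH]; first by rewrite !big_nil rmorph1 mulr1.
rewrite !big_cons IH rmorphM -!mulrA; congr (_ * _); rewrite !mulrA; congr (_ * _).
by apply: commr_prod => l _; rewrite /GRing.comm gen_cst.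
Qed.

Definition glin : ('I_n -> A) -> grassmann :=
  locked (fun u => \sum_i gen i * gcst (u i)).

Lemma glinE u : glin u = \sum_i gen i * gcst (u i).
Proof. by rewrite /glin -lock. Qed.

(** When the product is expanded, only the tuples that rearrange [S] reach the
    monomial [S], and the rearrangement costs its sign.  The coefficients stay in
    the order of the rows throughout, so that no commutation is needed. *)
Lemma glin_prod_coef d (z : 'I_d -> 'I_n -> A) (S : idx n d) :
  (\prod_k glin (z k)) (val S) =
  \sum_(s : 'S_d) (\prod_k z k (elt S (s k))) *~ (-1) ^+ s.
Proof.
under eq_bigr do rewrite glinE.
rewrite bigA_distr_bigA /= sum_ffunE.
under eq_bigr => f _ do rewrite prod_gen_cst gcstMr.
rewrite sum_ffun_idx => [|f fN]; last first.
  rewrite (prod_anti_noninj gen_anti gen_sq fN) gE.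
  by rewrite mul0r.
have term (T : idx n d) s : (\prod_k gen (elt_perm T s k)) (val S) = (T == S)%:R *~ (-1) ^+ s.
  under eq_bigr => k _ do rewrite gE.
  rewrite (@prod_anti_perm _ _ (fun k => gen (elt T k))) => [|i j]; last exact: gen_anti.
  rewrite -prod_gen_elt; case: (odd_perm s); rewrite ?mul1r //.
  by rewrite expr1 mulN1r mulrN1z gE.
rewrite (bigD1 S) //= [X in _ + X]big1 ?addr0; last first.
  by move=> T /negPf TS; rewrite big1 // => s _; rewrite term TS mul0rz mul0r.
apply: eq_bigr => s _; rewrite term eqxx mulrzAl mul1r; congr (_ *~ _).
by apply: eq_bigr => k _; rewrite gE.
Qed.

Lemma glinM u v :
  glin u * glin v = \sum_i \sum_j gen i * gen j * gcst (u i * v j).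
Proof.
rewrite !glinE mulr_suml; apply: eq_bigr => i _; rewrite mulr_sumr.
apply: eq_bigr => j _.
by rewrite -mulrA [X in _ * X]mulrA -gen_cst -[X in _ * X]mulrA -rmorphM mulrA.
Qed.

Lemma glin_anti u v : (forall i j, u i * v j = v j * u i) ->
  glin u * glin v = - (glin v * glin u).
Proof.
move=> uv; rewrite !glinM exchange_big -sumrN; apply: eq_bigr => i _.
by rewrite -sumrN; apply: eq_bigr => j _; rewrite gen_anti uv mulNr.
Qed.

(** The terms [(i, j)] and [(j, i)] cancel; pairing them avoids dividing by two. *)
Lemma glin_sq u : (forall i j, u i * u j = u j * u i) -> glin u * glin u = 0.
Proof.
move=> uu; rewrite glinM; pose F i j := gen i * gen j * gcst (u i * u j).
have FA i j : F i j = - F j i by rewrite /F gen_anti uu mulNr.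
transitivity (\sum_(i < n) \sum_(j < n | (j < i)%N) F i j +
              \sum_(i < n) \sum_(j < n | (i < j)%N) F i j).
  rewrite -big_split; apply: eq_bigr => i _ /=.
  rewrite (bigD1 i) //= gen_sq mul0r add0r (bigID (fun j : 'I_n => (j < i)%N)) /=.
  by congr (_ + _); apply: eq_bigl => j; rewrite -val_eqE /=; case: ltngtP.
rewrite [X in _ + X](exchange_big_dep xpredT) //= -big_split big1 // => i _.
by rewrite -big_split big1 //= => j _; rewrite FA addNr.
Qed.

End Grassmann.

(** * Powers of a sum of commuting quasi-idempotents *)

Section Coefficients.

Lemma coef_ab0 a b : coef_ab 0 a b = (a + b == 0)%:R.
Proof.
rewrite /coef_ab big_mkord; transitivity ((1 - 1 : int) ^+ (a + b)).
  rewrite exprDn; apply: eq_bigr => k _.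
  by rewrite expr0 mulr1 expr1n mul1r -mulr_natl natz.
by rewrite subrr expr0n.
Qed.

(** After reindexing, the three coefficients on the right are sums over the same
    powers [(b - k) ^ d] as the one on the left, and the identity holds for each
    [k] by the Pascal rule together with [k C(l, k) = l C(l - 1, k - 1)]. *)
Lemma coef_abS d a b : coef_ab d.+1 a b =
  (b%:Z - a%:Z) * coef_ab d a b + a%:Z * coef_ab d a.-1 b + b%:Z * coef_ab d a b.-1.
Proof.
case: (posnP (a + b)) => [/eqP|].
  rewrite addn_eq0 => /andP[/eqP -> /eqP ->].
  by rewrite /coef_ab big_nat1 subrr exprS !mul0r.
case def_l: (a + b)%N => [//|l] _.
pose G k : int := (b%:Z - k%:Z) ^+ d * (-1) ^+ k.
pose C' k : nat := if k is k'.+1 then 'C(l, k') else 0%N.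
have Ca : a%:Z * coef_ab d a.-1 b = \sum_(0 <= k < l.+2) (a%:Z * 'C(l, k)%:Z) * G k.
  case: a def_l => [|a] def_l; first by rewrite mul0r big1 // => k _; rewrite !mul0r.
  rewrite /coef_ab /= (_ : (a + b)%N = l); last by move: def_l; rewrite addSn => -[].
  rewrite [in RHS]big_nat_recr //= bin_small // mulr0 mul0r addr0 mulr_sumr.
  by apply: eq_bigr => k _; rewrite /G !mulrA.
have Cb : b%:Z * coef_ab d a b.-1 = \sum_(0 <= k < l.+2) (- (b%:Z * (C' k)%:Z)) * G k.
  case: b @G {Ca} def_l => [|b] G def_l.
    by rewrite mul0r big1 // => k _; rewrite !mul0r ?oppr0 ?mul0r.
  rewrite /coef_ab /= (_ : (a + b)%N = l); last by move: def_l; rewrite addnS => -[].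
  rewrite [in RHS]big_nat_recl //= mulr0 oppr0 mul0r add0r mulr_sumr.
  apply: eq_bigr => k _; rewrite /G exprS (_ : b.+1%:Z - k.+1%:Z = b%:Z - k%:Z); last by lia.
  by ring.
rewrite Ca Cb /coef_ab def_l mulr_sumr -!big_split /=; apply: eq_bigr => k _.
have Cl : 'C(l.+1, k)%:Z = 'C(l, k)%:Z + (C' k)%:Z.
  by case: k => [|k]; rewrite ?bin0 ?addr0 ?binS ?PoszD 1?addrC.
have Ck : k%:Z * 'C(l.+1, k)%:Z = (a%:Z + b%:Z) * (C' k)%:Z.
  rewrite -PoszD def_l -!PoszM; congr Posz; case: k {Cl} => [|k]; first by rewrite muln0.
  by rewrite /C' mul_bin_diag.
rewrite /G exprS.
have -> : 'C(l.+1, k)%:Z * ((b%:Z - k%:Z) * (b%:Z - k%:Z) ^+ d) * (-1) ^+ k =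
  (b%:Z * 'C(l.+1, k)%:Z - k%:Z * 'C(l.+1, k)%:Z) * ((b%:Z - k%:Z) ^+ d * (-1) ^+ k) by ring.
by rewrite Ck Cl; ring.
Qed.

Lemma coef_ab_small d a b : (d < a + b)%N -> coef_ab d a b = 0.
Proof.
elim: d a b => [|d IH] a b dab; first by rewrite coef_ab0 gtn_eqF.
rewrite coef_abS IH; last exact: ltnW.
rewrite mulr0 add0r; case: a dab => [|a] dab; case: b dab => [|b] dab;
  rewrite ?mul0r ?add0r ?addr0 ?IH ?mulr0 ?addr0 //=; lia.
Qed.

End Coefficients.

Section PowerOfSum.
Variables (R : nzRingType) (I : finType) (pos : {set I}).
Variables (x : I -> R) (t : R).
Hypothesis xx : forall a b, x a * x b = x b * x a.
Hypothesis tx : forall a, x a * t = t * x a.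

Definition block_sign (a : I) : int := if a \in pos then 1 else -1.

Hypothesis x_sq : forall a, x a * x a = - (t * x a *~ block_sign a).

Definition coef_set (d : nat) (J : {set I}) := coef_ab d #|J :&: pos| #|J :\: pos|.

Lemma sum_block_sign (J : {set I}) :
  \sum_(a in J) block_sign a = #|J :&: pos|%:Z - #|J :\: pos|%:Z.
Proof.
rewrite (bigID (mem pos)) /=; congr (_ + _).
  rewrite (eq_bigr (fun=> 1)) => [|a /andP[_ ap]]; last by rewrite /block_sign ap.
  by rewrite sumr_const natz; congr Posz; apply: eq_card => a; rewrite !inE.
rewrite (eq_bigr (fun=> -1)) => [|a /andP[_ /negPf ap]]; last by rewrite /block_sign ap.
by rewrite sumr_const mulNrn natz; congr (- Posz _); apply: eq_card => a; rewrite !inE andbC.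
Qed.

Lemma coef_setD1 d (J : {set I}) a : a \in J ->
  coef_set d (J :\ a) = if a \in pos then coef_ab d #|J :&: pos|.-1 #|J :\: pos|
                        else coef_ab d #|J :&: pos| #|J :\: pos|.-1.
Proof.
move=> aJ; rewrite /coef_set; case: ifP => ap; congr coef_ab.
- by rewrite [#|J :&: pos|](cardsD1 a) inE aJ ap /=; apply: eq_card => b; rewrite !inE andbA.
- by apply: eq_card => b; rewrite !inE; case: eqP => // ->; rewrite ap.
- by apply: eq_card => b; rewrite !inE; case: eqP => // ->; rewrite ap !andbF.
by rewrite [#|J :\: pos|](cardsD1 a) inE aJ ap /=; apply: eq_card => b; rewrite !inE andbCA.
Qed.

(** The recursion of [coef_abS] in the form in which multiplication by one more
    factor [x a] produces it: either [a] is new, or it is repeated and [x_sq]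
    applies. *)
Lemma coef_setS d (J : {set I}) :
  coef_set d.+1 J = \sum_(a in J) (coef_set d (J :\ a) - block_sign a * coef_set d J).
Proof.
rewrite sumrB -mulr_suml sum_block_sign [LHS]coef_abS -/(coef_set d J).
rewrite [in RHS](bigID (fun a => a \in pos)) /=.
set ca := coef_ab d _.-1 _; set cb := coef_ab d _ _.-1.
have -> : \sum_(a in J | a \in pos) coef_set d (J :\ a) = ca *+ #|J :&: pos|.
  rewrite -sumr_const; apply: eq_big => [a|a /andP[aJ ap]]; first by rewrite inE.
  by rewrite coef_setD1 ?ap.
have -> : \sum_(a in J | a \notin pos) coef_set d (J :\ a) = cb *+ #|J :\: pos|.
  rewrite -sumr_const; apply: eq_big => [a|a /andP[aJ /negPf ap]].
    by rewrite inE andbC.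
  by rewrite coef_setD1 ?ap.
by rewrite -[ca *+ _]mulr_natl -[cb *+ _]mulr_natl !natz; ring.
Qed.

Lemma coef_set_small d (J : {set I}) : (d < #|J|)%N -> coef_set d J = 0.
Proof. by move=> dJ; apply: coef_ab_small; rewrite cardsID. Qed.

(** Formally each [x a] is [- block_sign a * t] times an idempotent, so that
    [exp (z x_a) = 1 + x_a (1 - exp (- block_sign a z t)) / (block_sign a t)]; in
    the product of these exponentials, the coefficient of [z ^ d] on the product of
    the [x a] over [J] is [t ^ (d - #|J|) coef_set d J / d!].  The recursion on [d]
    avoids dividing by [t]. *)
Lemma sum_commuting_exp d : (\sum_a x a) ^+ d =
  \sum_(J : {set I}) (t ^+ (d - #|J|) * \prod_(a in J) x a) *~ coef_set d J.
Proof.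
elim: d => [|d IH].
  rewrite (bigD1 set0) //= [X in _ + X]big1 ?addr0 => [|J J0].
    by rewrite /coef_set set0I set0D cards0 coef_ab0 sub0n expr0 big_set0 mul1r.
  by rewrite coef_set_small ?mulr0z // card_gt0.
pose X (J : {set I}) := \prod_(a in J) x a.
have xX (J : {set I}) a : a \in J -> x a * X J = t * X J *~ - block_sign a.
  move=> aJ; rewrite /X -(setD1K aJ) prod_setU1_comm ?setD11 //.
  by rewrite mulrA x_sq mulNr mulrzAl mulrA mulrNz.
have xt a e : x a * t ^+ e = t ^+ e * x a by apply: commrX; apply: tx.
rewrite exprS IH mulr_sumr.
under eq_bigr => J _ do rewrite mulr_suml (bigID (mem J)) /=.
rewrite big_split /= -(sum_setD1 xpredT (fun a J =>
  x a * ((t ^+ (d - #|J|) * X J) *~ coef_set d J))).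
rewrite -big_split /=; apply: eq_bigr => J _; rewrite -big_split /=.
rewrite coef_setS [RHS]mulrz_sumr; apply: eq_bigr => a aJ.
rewrite -/(X J) mulrzBr addrC; congr (_ + _).
  rewrite mulrzAr; congr (_ *~ _); rewrite mulrA xt -mulrA -prod_setU1_comm ?setD11 //.
  by rewrite setD1K // [#|J|](cardsD1 a) aJ.
rewrite mulrzAr mulrA xt -mulrA xX // mulrzAr -mulrzA mulNr mulrNz.
have [dJ|dJ] := ltnP d #|J|; first by rewrite coef_set_small // mulr0 !mulr0z.
by rewrite mulrA -exprSr subSn.
Qed.

End PowerOfSum.

(** * Minors of matrices with canonical commutation relations *)

Section BilinearForms.
Variables (A : nzRingType) (n : nat).

Definition altsum d (M : 'I_d -> 'I_n -> 'I_n -> A) (S T : idx n d) : A :=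
  \sum_(s : 'S_d) \sum_(t : 'S_d)
    (\prod_k M k (elt S (s k)) (elt T (t k))) *~ ((-1) ^+ s * (-1) ^+ t).

(** Two commuting sets of generators: those of the outer exterior algebra carry
    the row index, those of the inner one the column index. *)
Definition gbil (M : 'I_n -> 'I_n -> A) : grassmann (grassmann A n) n :=
  glin (fun i => glin (M i)).

Lemma ffunMzE (V : zmodType) (I : finType) (f : {ffun I -> V}) (k : int) (i : I) :
  (f *~ k) i = f i *~ k.
Proof. by case: k => k; rewrite ?ffunE ffunMnE. Qed.

Lemma gbil_prod_coef d (M : 'I_d -> 'I_n -> 'I_n -> A) (S T : idx n d) :
  (\prod_k gbil (M k)) (val S) (val T) = altsum M S T.
Proof.
rewrite glin_prod_coef sum_ffunE; apply: eq_bigr => s _.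
rewrite ffunMzE glin_prod_coef mulrz_suml; apply: eq_bigr => t _.
by rewrite -mulrzA mulrC.
Qed.

End BilinearForms.

Section CanonicalRelations.
Variables (A : nzRingType) (m n : nat) (P Q : 'M[A]_(m, n)) (pos : {set 'I_n}).
Notation eta := (block_sign pos).

Hypothesis PP : forall s t a b, P s a * P t b = P t b * P s a.
Hypothesis QQ : forall s t a b, Q s a * Q t b = Q t b * Q s a.
Hypothesis QP : forall s t a b, Q t b * P s a =
  P s a * Q t b + 1 *~ (((s == t) && (a == b))%:R * eta a).

Lemma det_minor_row d (M : 'M[A]_(m, n)) (S : idx m d) (J : idx n d) :
  \sum_(s : 'S_d) (\prod_k M (elt S k) (elt J (s k))) *~ (-1) ^+ s =
  \det (minor_mx S J M).
Proof.
apply: eq_bigr => s _.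
have -> : \prod_k minor_mx S J M k (s k) = \prod_k M (elt S k) (elt J (s k)).
  by apply: eq_bigr => k _; rewrite mxE.
by case: (odd_perm s); rewrite ?mulrN1z ?mulN1r ?mulr1z ?mul1r.
Qed.

Lemma det_minor_col d (M : 'M[A]_(m, n)) (S : idx m d) (J : idx n d) :
  (forall s t a b, M s a * M t b = M t b * M s a) ->
  \sum_(s : 'S_d) (\prod_k M (elt S (s k)) (elt J k)) *~ (-1) ^+ s =
  \det (minor_mx S J M).
Proof.
move=> MC; rewrite -det_minor_row (reindex_inj invg_inj) /=.
apply: eq_bigr => s _; rewrite odd_permV; congr (_ *~ _).
rewrite -(prod_perm_comm s) //; apply: eq_bigr => k _.
by rewrite permK.
Qed.

Lemma prod_idx d (R : pzRingType) (J : idx n d) (F : 'I_n -> R) :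
  (forall a b, F a * F b = F b * F a) ->
  \prod_(a in val J) F a = \prod_(a <- [seq elt J k | k <- index_enum 'I_d]) F a.
Proof.
move=> FC; rewrite -big_filter; apply: perm_prod_comm => //; apply: uniq_perm => [||a].
- by rewrite filter_uniq ?index_enum_uniq.
- by rewrite map_inj_uniq ?index_enum_uniq //; apply: elt_inj.
rewrite mem_filter mem_index_enum andbT -(elt_permK J 1).
by apply/imsetP/mapP => -[k _ ->]; exists k; rewrite ?mem_index_enum // ?ffunE ?perm1.
Qed.

(** The sums of [P s a] against row generators: this is the side on which the
    matrix [P Q^T] acts, and where the powers of [\sum_a x a] are computed. *)
Section RowSpace.
Notation inner := (grassmann A m).
Notation outer := (grassmann inner m).

Let alpha a : outer := glin (fun s => gcst m (P s a)).
Let beta a : outer := gcst m (glin (fun t => Q t a)).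
Let theta : outer := glin (@gen A m).
Let x a : outer := alpha a * beta a.

Let alphaC a b : alpha a * alpha b = - (alpha b * alpha a).
Proof. by apply: glin_anti => s t; rewrite -!gcstM PP. Qed.

Let alpha_sq a : alpha a * alpha a = 0.
Proof. by apply: glin_sq => s t; rewrite -!gcstM PP. Qed.

Let betaC a b : beta a * beta b = - (beta b * beta a).
Proof. by rewrite -!gcstM -gcstN; congr (gcst _ _); apply: glin_anti => s t; apply: QQ. Qed.

Let theta_alpha a : theta * alpha a = - (alpha a * theta).
Proof. by apply: glin_anti => s t; apply: gen_cst. Qed.

Lemma gen_glin_anti (R : nzRingType) k (s : 'I_k) (u : 'I_k -> R) :
  gen R s * glin u = - (glin u * gen R s).
Proof.
rewrite glinE mulr_sumr mulr_suml -sumrN; apply: eq_bigr => t _.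
by rewrite mulrA gen_anti mulNr -!mulrA gen_cst.
Qed.

Let theta_beta a : theta * beta a = - (beta a * theta).
Proof.
rewrite /theta glinE mulr_suml mulr_sumr -sumrN; apply: eq_bigr => s _.
rewrite mulrA -gen_cst -!mulrA -!gcstM -mulrN -gcstN; congr (_ * gcst _ _).
exact: gen_glin_anti.
Qed.

Let theta_x a : x a * theta = theta * x a.
Proof.
rewrite /x mulrA theta_alpha mulNr -!mulrA theta_beta.
by rewrite mulrN opprK.
Qed.

Let beta_alpha a b :
  beta b * alpha a = alpha a * beta b + theta *~ ((a == b)%:R * eta a).
Proof.
rewrite /alpha /theta !glinE mulr_sumr mulr_suml mulrz_suml -big_split.
apply: eq_bigr => s _ /=; rewrite mulrA -gen_cst -!mulrA -!gcstM -mulrzAr -mulrDr -gcstMz -gcstD.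
congr (_ * gcst _ _); rewrite glinE mulr_suml mulr_sumr.
under eq_bigr => t _.
  rewrite -mulrA -gcstM QP gcstD mulrDr gcstM mulrA gen_cst -mulrA.
  rewrite gcstMz rmorph1 mulrzAr mulr1.
over.
rewrite big_split; congr (_ + _) => /=.
rewrite (bigD1 s) //= eqxx big1 ?addr0 // => t /negPf ts.
by rewrite eq_sym ts mul0r mulr0z.
Qed.

Let beta_alpha_neq a b : a != b -> beta b * alpha a = alpha a * beta b.
Proof. by move=> /negPf ab; rewrite beta_alpha ab mul0r mulr0z addr0. Qed.

Let xC a b : x a * x b = x b * x a.
Proof.
have [->//|ab] := eqVneq a b.
rewrite /x -!mulrA (mulrA (beta a)) beta_alpha_neq 1?eq_sym //.
rewrite (mulrA (beta b)) beta_alpha_neq // -!mulrA betaC !mulrA alphaC.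
by rewrite mulrNN !mulrA.
Qed.

(** [alpha a] squares to zero, so that only the commutator of [beta a] with
    [alpha a] survives. *)
Let x_sq a : x a * x a = - (theta * x a *~ eta a).
Proof.
rewrite /x -!mulrA (mulrA (beta a)) beta_alpha eqxx mul1r mulrDl mulrDr.
rewrite !mulrA alpha_sq !mul0r add0r mulrzAr mulrzAl.
by rewrite theta_alpha !mulNr mulNrz opprK.
Qed.

Let prod_x (s : seq 'I_n) : uniq s ->
  \prod_(a <- s) x a = \prod_(a <- s) alpha a * \prod_(a <- s) beta a.
Proof.
elim: s => [|a s IH] /=; first by rewrite !big_nil mulr1.
move=> /andP[a_s s_uniq]; rewrite !big_cons IH // /x -!mulrA; congr (_ * _).
rewrite !mulrA; congr (_ * _); rewrite !big_seq.
apply: commr_prod => b bs; rewrite /GRing.comm beta_alpha_neq //.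
by apply: contraNneq a_s => <-.
Qed.

(** On the [d]-th power of the bilinear form of a matrix this is [d!] times the
    sum of the symmetrized principal minors of size [d]. *)
Definition gtrace d (y : outer) : A := \sum_(S : {set 'I_m} | #|S| == d) y S S.

Let gtrace_sum d (I : finType) (y : I -> outer) :
  gtrace d (\sum_i y i) = \sum_i gtrace d (y i).
Proof.
rewrite exchange_big; apply: eq_bigr => S _ /=.
by rewrite !sum_ffunE.
Qed.

Let gtraceMz d (y : outer) k : gtrace d (y *~ k) = gtrace d y *~ k.
Proof. by rewrite mulrz_suml; apply: eq_bigr => S _; rewrite !ffunMzE. Qed.

(** A set [S] of size [d] is obtained by removing an element from a set of size
    [d.+1] in [m - d] ways; the two signs involved are equal, one for each set of
    generators. *)
Let gtrace_theta d (y : outer) : gtrace d.+1 (theta * y) = gtrace d y *+ (m - d).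
Proof.
rewrite /gtrace; transitivity (\sum_(S : {set 'I_m} | #|S| == d.+1)
    \sum_(i in S) y (S :\ i) (S :\ i)).
  apply: eq_bigr => S _; rewrite /theta glinE mulr_suml !sum_ffunE [RHS]big_mkcond /=.
  apply: eq_bigr => i _; rewrite -mulrA genMl; case: ifP => iS; last by rewrite ffunE.
  rewrite ffunMzE gcstMl genMl iS -mulrzA gsign1_sq ?mulr1z //.
  by rewrite !inE eqxx.
rewrite (sum_setD1 (pred1 d.+1) (fun _ S => y S S)) -sumrMnl.
apply: eq_big => [S|S /eqP cS]; first by rewrite /= eqSS.
rewrite sumr_const; congr (_ *+ _).
rewrite (_ : #|_| = #|~: S|); last by apply: eq_card => i; rewrite !inE.
by rewrite cardsCs setCK card_ord; case: cS => ->.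
Qed.

Let gtrace_thetaX l r (y : outer) :
  gtrace (l + r)%N (theta ^+ r * y) = gtrace l y *+ (m - l) ^_ r.
Proof.
elim: r => [|r IH]; first by rewrite addn0 expr0 mul1r.
by rewrite addnS exprS -mulrA gtrace_theta IH -mulrnA ffactnSr subnDA.
Qed.

Let gtrace_x l (J : idx n l) : gtrace l (\prod_(a in val J) x a) =
  \sum_(S : idx m l) \det (minor_mx S J P) * \det (minor_mx S J Q).
Proof.
rewrite (prod_idx J xC) prod_x; last first.
  by rewrite map_inj_uniq ?index_enum_uniq //; apply: elt_inj.
rewrite !big_map -(rmorph_prod (gcst m)) /=.
set y : outer := _ * _; rewrite /gtrace -(sum_idx l (fun S => y S S)).
apply: eq_bigr => S _; rewrite /y gcstMr glin_prod_coef.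
under [X in X * _]eq_bigr => s _ do rewrite -(rmorph_prod (gcst m)) -gcstMz.
by rewrite -(rmorph_sum (gcst m)) gcstMl glin_prod_coef !det_minor_col.
Qed.

(** For [P Q^T], expanded by [sum_commuting_exp]: the product of the [x a] over [J]
    separates into the product of the [alpha a], whose coefficients are minors of
    [P], and that of the [beta a], whose coefficients are minors of [Q]. *)
Lemma sum_principal_altsum d :
  \sum_(S : idx m d) altsum (fun=> (fun s t => \sum_a P s a * Q t a)) S S =
  \sum_(0 <= l < d.+1) (\sum_(J : idx n l)
     (\sum_(S : idx m l) \det (minor_mx S J P) * \det (minor_mx S J Q))
       *~ coef_set pos d (val J)) *+ (m - l) ^_ (d - l).
Proof.
transitivity (gtrace d ((\sum_a x a) ^+ d)).
  have -> : \sum_a x a = gbil (fun s t => \sum_a P s a * Q t a).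
    rewrite /gbil glinE; under eq_bigr => a _ do rewrite /x /alpha /beta !glinE mulr_suml.
    rewrite exchange_big; apply: eq_bigr => s _ /=.
    under eq_bigr => a _ do rewrite -mulrA -gcstM.
    rewrite -mulr_sumr -(rmorph_sum (gcst m)); congr (_ * gcst _ _) => /=.
    rewrite glinE; under eq_bigr => a _ do rewrite mulr_sumr.
    rewrite exchange_big; apply: eq_bigr => t _ /=; rewrite (rmorph_sum (gcst m)) mulr_sumr.
    by apply: eq_bigr => a _; rewrite mulrA -gen_cst -mulrA -gcstM.
  set y : outer := _ ^+ d; rewrite /gtrace -(sum_idx d (fun S => y S S)).
  by apply: eq_bigr => S _; rewrite /y -gbil_prod_coef prodr_const card_ord.
rewrite (sum_commuting_exp xC theta_x x_sq) gtrace_sum (sum_set_card (d := d)); last first.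
  by move=> J dJ; rewrite coef_set_small // /gtrace big1 // => S _; rewrite !ffunE.
apply: eq_big_nat => l /andP[_ ld]; rewrite -sumrMnl; apply: eq_bigr => J _.
rewrite gtraceMz (eqP (valP J)).
have := gtrace_thetaX l (d - l) (\prod_(a in val J) x a).
by rewrite subnKC // => ->; rewrite gtrace_x !pmulrn -!mulrzA mulrC.
Qed.

End RowSpace.

(** The sums of [P s a] against column generators, for the matrix [P^T Q].  Here
    the commutator of [kappa s] and [pi s] does not depend on [s]. *)
Section ColumnSpace.
Notation inner := (grassmann A n).
Notation outer := (grassmann inner n).

Let pi s : outer := glin (fun a => gcst n (P s a)).
Let kappa s : outer := gcst n (glin (Q s)).
Let theta : outer := glin (fun a => gen A a *~ eta a).
Let omega : outer := \sum_s pi s * kappa s.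

Let piC s t : pi s * pi t = - (pi t * pi s).
Proof. by apply: glin_anti => a b; rewrite -!rmorphM PP. Qed.

Let pi_sq s : pi s * pi s = 0.
Proof. by apply: glin_sq => a b; rewrite -!rmorphM PP. Qed.

Let kappaC s t : kappa s * kappa t = - (kappa t * kappa s).
Proof. by rewrite -!gcstM -gcstN; congr (gcst _ _); apply: glin_anti => a b; apply: QQ. Qed.

Let theta_pi s : theta * pi s = - (pi s * theta).
Proof. by apply: glin_anti => a b; rewrite mulrzAl gen_cst -mulrzAr. Qed.

Let kappa_pi s t :
  kappa t * pi s = pi s * kappa t + theta *~ (s == t)%:R.
Proof.
rewrite /pi /theta !glinE mulr_sumr mulr_suml mulrz_suml -big_split.
apply: eq_bigr => a _ /=.
rewrite mulrA -gen_cst -!mulrA -!gcstM -mulrzAr -mulrDr -gcstMz -gcstD.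
congr (_ * gcst _ _); rewrite glinE mulr_suml mulr_sumr.
under eq_bigr => b _.
  rewrite -mulrA -gcstM QP gcstD mulrDr gcstM mulrA gen_cst -mulrA.
  rewrite gcstMz rmorph1 mulrzAr mulr1.
over.
rewrite big_split; congr (_ + _) => /=.
rewrite (bigD1 a) //= eqxx andbT big1 ?addr0; last first.
  by move=> b /negPf ba; rewrite [a == b]eq_sym ba andbF mul0r mulr0z.
by rewrite mulrC mulrzA.
Qed.

(** [pi s] is moved to the left of [omega] past the two factors of each
    [pi t * kappa t]: the first changes the sign, the second leaves [theta]. *)
Let omega_pi s : omega * pi s = - (pi s * omega) - theta * pi s.
Proof.
rewrite mulr_suml; under eq_bigr => t _.
  rewrite -mulrA kappa_pi mulrDr mulrA piC mulNr -mulrA.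
over.
rewrite big_split /= sumrN -mulr_sumr; congr (- (_ * _) + _).
rewrite (bigD1 s) //= eqxx mulr1z big1 ?addr0 ?theta_pi ?opprK //.
by move=> t /negPf ts; rewrite eq_sym ts mulr0.
Qed.

(** Each [pi s] that is crossed uses up one copy of [theta], by [omega_pi]. *)
Let omega_prod_pi (g : seq 'I_m) :
  (omega + theta *+ size g) * \prod_(s <- g) pi s =
  (-1) ^+ size g * (\prod_(s <- g) pi s * omega).
Proof.
have step k s : (omega + theta *+ k.+1) * pi s = - (pi s * (omega + theta *+ k)).
  rewrite mulrDl omega_pi mulrSr [X in _ + X]mulrDl addrACA addNr addr0.
  by rewrite mulrnAl theta_pi mulNrn -mulrnAr -opprD -mulrDr.
elim: g => [|s g IH]; first by rewrite big_nil addr0 mulr1 !mul1r.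
rewrite big_cons mulrA -[size (s :: g)]/(size g).+1 step mulNr.
rewrite -(mulrA (pi s) (omega + _)) IH exprS mulN1r mulNr.
by congr (- _); rewrite [LHS]mulrA (commr_sign _ _ : _ = _) -!mulrA.
Qed.

(** The leftmost factor has its shift exhausted by crossing the [l] factors
    [pi] already present, which leaves room to insert one more pair
    [pi s * kappa s] between them and the factors [kappa]. *)
Let prod_omega l : \prod_(k < l) (omega + theta *+ (l.-1 - k)) =
  \sum_(g : {ffun 'I_l -> 'I_m}) \prod_k pi (g k) * \prod_k kappa (g k).
Proof.
elim: l => [|l IH].
  rewrite big_ord0 (bigD1 (ffun0 (card_ord 0))) //= !big_ord0 mulr1 big1 ?addr0 //.
  by move=> g /eqP[]; apply/ffunP => -[].
rewrite big_ord_recl subn0 /=.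
under [X in _ * X]eq_bigr => k _ do rewrite /bump /= add1n subnS predn_sub.
rewrite IH mulr_sumr.
pose cons s (g : {ffun 'I_l -> 'I_m}) : {ffun 'I_l.+1 -> 'I_m} :=
  [ffun k => if unlift ord0 k is Some k' then g k' else s].
have cons0 s g : cons s g ord0 = s by rewrite ffunE unlift_none.
have consS s g k : cons s g (lift ord0 k) = g k by rewrite ffunE liftK.
rewrite [RHS](reindex (fun sg => cons sg.1 sg.2)) /=; last first.
  exists (fun f => (f ord0, [ffun k => f (lift ord0 k)])) => [[s g] _|f _] /=.
    by rewrite cons0; congr (_, _); apply/ffunP => k; rewrite ffunE consS.
  apply/ffunP => k; rewrite ffunE; case: unliftP => [j ->|->] //.
  by rewrite ffunE.
rewrite -(pair_bigA _ (fun s g => \prod_k pi (cons s g k) * \prod_k kappa (cons s g k))) /=.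
rewrite exchange_big; apply: eq_bigr => g _ /=.
under [RHS]eq_bigr => s _.
  rewrite !big_ord_recl !cons0.
  under eq_bigr => k _ do rewrite consS.
  under [X in _ * (_ * X)]eq_bigr => k _ do rewrite consS.
over.
rewrite mulrA -(big_map g xpredT pi).
have := omega_prod_pi [seq g k | k <- index_enum 'I_l].
rewrite size_map [X in _ *+ X](_ : _ = l); last first.
  by rewrite /index_enum unlock -enumT size_enum_ord.
move=> ->; rewrite -(size_map g); set G := map g _.
rewrite {1}/omega !mulr_sumr mulr_suml; apply: eq_bigr => s _.
by rewrite (prod_anti_swap G (piC s)) !mulrA.
Qed.

Let omega_theta c : omega + theta *+ c =
  gbil (fun a b => \sum_s P s a * Q s b + ((a == b)%:R *~ eta a) *+ c).
Proof.
rewrite /gbil /omega /theta [in LHS]glinE [in RHS]glinE -sumrMnl.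
under eq_bigr => s _ do rewrite /pi /kappa glinE mulr_suml.
rewrite exchange_big -big_split; apply: eq_bigr => a _ /=.
under eq_bigr => s _ do rewrite -mulrA -gcstM.
rewrite -mulr_sumr -(rmorph_sum (gcst n)) -mulrnAr -(rmorphMn (gcst n)) -mulrDr -gcstD.
congr (_ * gcst _ _) => /=; rewrite glinE.
under eq_bigr => s _ do rewrite glinE mulr_sumr.
rewrite exchange_big [X in _ + X](_ : _ =
    \sum_b gen A b * gcst n (((a == b)%:R *~ eta a) *+ c)); last first.
  rewrite (bigD1 a) //= eqxx big1 ?addr0 => [|b /negPf ba].
    by rewrite (rmorphMn (gcst n)) (rmorphMz (gcst n)) rmorph1 mulrnAr mulrzAr mulr1.
  by rewrite [a == b]eq_sym ba mul0rz mul0rn rmorph0 mulr0.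
rewrite -big_split; apply: eq_bigr => b _ /=; rewrite gcstD mulrDr; congr (_ + _).
rewrite (rmorph_sum (gcst n)) mulr_sumr; apply: eq_bigr => s _.
by rewrite mulrA -gen_cst -mulrA -gcstM.
Qed.

(** A Capelli identity: the diagonal shifts are exactly those that make
    [prod_omega] normally ordered. *)
Lemma capelli_altsum l (I J : idx n l) :
  altsum (fun k a b => \sum_s P s a * Q s b +
                       ((a == b)%:R *~ eta a) *+ (l.-1 - k)) I J =
  (\sum_(S : idx m l) \det (minor_mx S I P) * \det (minor_mx S J Q)) *+ l`!.
Proof.
rewrite -gbil_prod_coef; under eq_bigr do rewrite -omega_theta.
rewrite prod_omega sum_ffun_idx => [|g gN]; last first.
  by rewrite (prod_anti_noninj piC pi_sq gN) mul0r.
rewrite !sum_ffunE -sumrMnl; apply: eq_bigr => S _.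
have term s : \prod_k pi (elt_perm S s k) * \prod_k kappa (elt_perm S s k) =
    \prod_k pi (elt S k) * \prod_k kappa (elt S k).
  under eq_bigr => k _ do rewrite ffunE.
  under [X in _ * X]eq_bigr => k _ do rewrite ffunE.
  rewrite (@prod_anti_perm _ _ (fun k => pi (elt S k))) => [|i j]; last exact: piC.
  rewrite (@prod_anti_perm _ _ (fun k => kappa (elt S k))) => [|i j]; last exact: kappaC.
  by case: (odd_perm s); rewrite ?expr1 ?expr0 ?mulN1r ?mul1r ?mulrNN.
under eq_bigr => s _ do rewrite term.
rewrite sumr_const card_Sn ffunMnE ffunMnE; congr (_ *+ _).
rewrite -(rmorph_prod (gcst n)) /= gcstMr glin_prod_coef.
under [X in X * _]eq_bigr => s _ do rewrite -(rmorph_prod (gcst n)) -gcstMz.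
by rewrite -(rmorph_sum (gcst n)) gcstMl glin_prod_coef !det_minor_row.
Qed.

End ColumnSpace.
End CanonicalRelations.

(** * Invariance of sums of symmetrized principal minors under conjugation *)

Section Conjugation.
Variables (F : numFieldType) (U : algType F) (n l : nat).
Notation tuples := {ffun 'I_l -> 'I_n}.
Implicit Types (M : 'I_l -> 'I_n -> 'I_n -> U) (f u v : tuples) (w : tuples -> F).

(** One of the two permutations of [altsum] has been absorbed in the tuple. *)
Definition alt_tuple M f : U :=
  \sum_(s : 'S_l) (\prod_k M k (f k) (f (s k))) *~ (-1) ^+ s.

(** Composing with the transposition of two equal indices changes the sign only. *)
Lemma alt_tuple_noninj M f : ~~ injectiveb f -> alt_tuple M f = 0.
Proof.
move=> /injectivePn[i [j ij fij]].
have alt_opp : alt_tuple M f = - alt_tuple M f.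
  rewrite {1}/alt_tuple (reindex_inj (mulIg (tperm i j))) -sumrN.
  apply: eq_bigr => s _; rewrite odd_permM odd_tperm ij signr_addb mulrN1 mulrNz.
  congr (- (_ *~ _)); apply: eq_bigr => k _; rewrite permM.
  by case: tpermP => // ->; rewrite fij.
apply/eqP; have /eqP : 2%:R *: alt_tuple M f = 0 :> U.
  by rewrite scaler_nat mulr2n {1}alt_opp addNr.
by rewrite scaler_eq0 pnatr_eq0.
Qed.

Lemma sum_altsum_tuples w M :
  (forall f (s : 'S_l), w [ffun k => f (s k)] = w f) ->
  \sum_(J : idx n l) w [ffun k => elt J k] *: altsum M J J =
  \sum_f w f *: alt_tuple M f.
Proof.
move=> ws; rewrite (@sum_ffun_idx n l) => [|f /alt_tuple_noninj ->]; last by rewrite scaler0.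
apply: eq_bigr => J _; rewrite scaler_sumr; apply: eq_bigr => s _.
have -> : w (elt_perm J s) = w [ffun k => elt J k].
  by rewrite -(ws [ffun k => elt J k] s); congr w; apply/ffunP => k; rewrite !ffunE.
congr (_ *: _); rewrite /alt_tuple (reindex_inj (mulIg s)); apply: eq_bigr => t _ /=.
rewrite odd_permM signr_addb mulrCA -signr_addb addbb mulr1; congr (_ *~ _).
by apply: eq_bigr => k _; rewrite !ffunE permM.
Qed.

(** Over all tuples, each permutation contributes a full contraction of the
    factors [M k], in which the change of basis [A] meets its inverse [B] at
    every index.  The weight may depend on the tuple as long as [A] has no entry
    between tuples of different weight. *)
Lemma sum_alt_tuple_conj w M (A B : 'M[F]_n) :
  B *m A = 1%:M ->
  (forall f u, (forall k, A (f k) (u k) != 0) -> w f = w u) ->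
  \sum_f w f *: alt_tuple
    (fun k i j => \sum_a \sum_b (A i a * B b j) *: M k a b) f =
  \sum_f w f *: alt_tuple M f.
Proof.
move=> BA wA.
have expand f : alt_tuple (fun k i j => \sum_a \sum_b (A i a * B b j) *: M k a b) f =
    \sum_(s : 'S_l) \sum_(u : tuples) \sum_(v : tuples)
      (\prod_k A (f k) (u k) * \prod_k B (v k) (f (s k))) *:
        (\prod_k M k (u k) (v k)) *~ (-1) ^+ s.
  apply: eq_bigr => s _; rewrite bigA_distr_bigA mulrz_suml; apply: eq_bigr => u _.
  rewrite bigA_distr_bigA mulrz_suml; apply: eq_bigr => v _.
  by rewrite scaler_prod big_split scalerMzr.
(* The sum over the tuple [f] contracts [A] with [B], up to the permutation. *)
have weight (s : 'S_l) u v : \sum_(f : tuples)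
    w f * (\prod_k A (f k) (u k) * \prod_k B (v k) (f (s k))) =
    w u * (v == [ffun k => u (s k)])%:R.
  transitivity (w u * \sum_(f : tuples) \prod_k (B (v ((s^-1)%g k)) (f k) * A (f k) (u k))).
    rewrite mulr_sumr; apply: eq_bigr => f _; rewrite big_split /=.
    rewrite [X in _ = _ * (X * _)](reindex_inj (@perm_inj _ s)) /=.
    under [X in _ = _ * (X * _)]eq_bigr => k _ do rewrite permK.
    rewrite [X in _ = _ * X]mulrC.
    have [/forallP Afu|/forallPn[k /negbNE/eqP Afu]] := boolP [forall k, A (f k) (u k) != 0].
      by rewrite (wA f u).
    by rewrite (bigD1 k) //= Afu !mul0r !mulr0.
  congr (_ * _); 
  rewrite -(bigA_distr_bigA (fun k i => B (v ((s^-1)%g k)) i * A i (u k))) /=.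
  transitivity (\prod_k ((v ((s^-1)%g k) == u k)%:R : F)).
    apply: eq_bigr => k _; have := congr1 (fun X : 'M_n => X (v ((s^-1)%g k)) (u k)) BA.
    by rewrite !mxE.
  case: eqP => [->|vu].
    by rewrite big1 // => k _; rewrite ffunE permKV eqxx.
  have [k ku] : exists k, v ((s^-1)%g k) != u k.
    apply/existsP; apply: contra_notT vu => /existsPn vu.
    apply/ffunP => k; rewrite ffunE; have := vu (s k).
    by rewrite permK negbK => /eqP.
  by rewrite (bigD1 k) //= (negPf ku) mul0r.
under eq_bigr => f _ do rewrite expand scaler_sumr.
rewrite exchange_big /=; under [RHS]eq_bigr => f _ do rewrite scaler_sumr.
rewrite [RHS]exchange_big /=; apply: eq_bigr => s _.
under eq_bigr => f _ do rewrite scaler_sumr.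
rewrite exchange_big /=; apply: eq_bigr => u _.
under eq_bigr => f _ do rewrite scaler_sumr.
rewrite exchange_big /=.
under eq_bigr => v _.
  under eq_bigr => f _ do rewrite -scalerMzr scalerA.
  rewrite -mulrz_suml -scaler_suml weight.
over.
rewrite (bigD1 [ffun k => u (s k)]) //= eqxx mulr1 [X in _ + X]big1 ?addr0 => [|v /negPf vu].
  rewrite scalerMzr; congr (_ *: (_ *~ _)); apply: eq_bigr => k _.
  by rewrite ffunE.
by rewrite vu mulr0 scale0r mul0rz.
Qed.

End Conjugation.

Section SymmetrizedDeterminants.
Variables (F : numClosedFieldType) (U : algType F).

Lemma emb_mxE n (A : 'M[F]_n) : emb_mx U A = map_mx (in_alg U) A.
Proof. by apply/matrixP => i j; rewrite !mxE. Qed.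

Lemma emb_conjE n (A B : 'M[F]_n) (M : 'M[U]_n) i j :
  (emb_mx U A *m M *m emb_mx U B) i j = \sum_a \sum_b (A i a * B b j) *: M a b.
Proof.
rewrite mxE exchange_big; apply: eq_bigr => b _ /=; rewrite mxE mulr_suml.
apply: eq_bigr => a _; rewrite !mxE mulr_algl mulr_algr scalerA.
by rewrite mulrC.
Qed.

Lemma scale_signs d (s t : 'S_d) (x : U) :
  ((-1) ^+ s * (-1) ^+ t : F) *: x = x *~ ((-1) ^+ s * (-1) ^+ t).
Proof. by rewrite -scaler_int rmorphM !rmorph_sign. Qed.

Lemma symdet_minor n d (M : 'M[U]_n) (S : idx n d) :
  symdet (minor_mx S S M) = (d`!%:R : F)^-1 *: altsum (fun=> M) S S.
Proof.
congr (_ *: _); apply: eq_bigr => s _; apply: eq_bigr => t _.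
by rewrite scale_signs; congr (_ *~ _); apply: eq_bigr => k _; rewrite mxE.
Qed.

Lemma symdet_pqE p q l (B : 'M[U]_(p + q)) (I J : idx (p + q) l) (u : 'I_l -> F) :
  symdet_pq B I J u = (l`!%:R : F)^-1 *:
    altsum (fun k => B + emb_mx U (u k *: I_pq F p q)) I J.
Proof.
congr (_ *: _); apply: eq_bigr => s _; apply: eq_bigr => t _.
rewrite scale_signs; congr (_ *~ _); apply: eq_bigr => k _.
by rewrite !mxE mulrN scaleNr opprK.
Qed.

End SymmetrizedDeterminants.

Lemma rmorph_altsum (R R' : nzRingType) (phi : {rmorphism R -> R'}) n d
    (M : 'I_d -> 'I_n -> 'I_n -> R) (S T : idx n d) :
  phi (altsum M S T) = altsum (fun k i j => phi (M k i j)) S T.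
Proof.
rewrite rmorph_sum; apply: eq_bigr => s _; rewrite rmorph_sum; apply: eq_bigr => t _.
by rewrite rmorphMz rmorph_prod.
Qed.

Lemma eq_altsum (R : nzRingType) n d (M M' : 'I_d -> 'I_n -> 'I_n -> R) (S T : idx n d) :
  (forall k i j, M k i j = M' k i j) -> altsum M S T = altsum M' S T.
Proof.
move=> MM'; apply: eq_bigr => s _; apply: eq_bigr => t _; congr (_ *~ _).
by apply: eq_bigr => k _.
Qed.

Section Invariance.
Variables (F : numClosedFieldType) (U : algType F) (n l : nat).

(** How invariance under a group is proved: a group element acts on the
    generators as an algebra endomorphism [phi], and the effect of [phi] on the
    matrices [M k] is a conjugation. *)
Lemma sum_altsum_conj (w : {ffun 'I_l -> 'I_n} -> F) (phi : {rmorphism U -> U})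
    (A B : 'M[F]_n) (M : 'I_l -> 'M[U]_n) :
  B *m A = 1%:M ->
  (forall (f : {ffun 'I_l -> 'I_n}) (s : 'S_l), w [ffun k => f (s k)] = w f) ->
  (forall f u : {ffun 'I_l -> 'I_n}, (forall k, A (f k) (u k) != 0) -> w f = w u) ->
  (forall k, map_mx phi (M k) = emb_mx U A *m M k *m emb_mx U B) ->
  \sum_(J : idx n l) w [ffun k => elt J k] *: phi (altsum M J J) =
  \sum_(J : idx n l) w [ffun k => elt J k] *: altsum M J J.
Proof.
move=> BA ws wA phiM.
rewrite [RHS]sum_altsum_tuples // -(sum_alt_tuple_conj M BA wA) -sum_altsum_tuples //.
apply: eq_bigr => J _; congr (_ *: _); rewrite rmorph_altsum.
apply: eq_altsum => k i j.
by have := congr1 (fun X : 'M_n => X i j) (phiM k); rewrite mxE emb_conjE.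
Qed.

End Invariance.

Section AdjointAction.
Variables (F : numClosedFieldType).

Lemma linear_mxE (V : lmodType F) n (g : 'M[F]_n -> V) M :
  (forall a x y, g (a *: x + y) = a *: g x + g y) ->
  g M = \sum_a \sum_b M a b *: g (delta_mx a b).
Proof.
move=> lin; have gD : {morph g : x y / x + y}.
  by move=> x y; have := lin 1 x y; rewrite !scale1r.
have g0 : g 0 = 0 by apply: (addrI (g 0)); rewrite -gD !addr0.
rewrite {1}[M]matrix_sum_delta (big_morph _ gD g0); apply: eq_bigr => a _.
rewrite (big_morph _ gD g0); apply: eq_bigr => b _.
by rewrite -[M a b *: delta_mx a b]addr0 lin g0 addr0.
Qed.

Lemma Ad_gl_delta n (g : 'M[F]_n) i j a b :
  Ad_gl g (delta_mx i j) a b = g a i * invmx g j b.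
Proof.
rewrite mxE (bigD1 j) //= big1 ?addr0 => [|c /negPf cj].
  rewrite mxE (bigD1 i) //= big1 ?addr0 => [|c /negPf ci].
    by rewrite mxE !eqxx mulr1.
  by rewrite mxE ci mulr0.
rewrite mxE big1 ?mul0r // => e _.
by rewrite mxE cj andbF mulr0.
Qed.

End AdjointAction.

Section InvarianceX.
Variables (F : numClosedFieldType) (m p q : nat).
Notation Ug := (uea (lie_g F m)).
Variables (k : 'M[F]_m) (hk : k \in unitmx).
Let phi : {lrmorphism Ug -> Ug} := uea_map (Ad_K_hom hk).

Let phi_iota x : phi (uea_iota x) = uea_iota (Ad_K k x).
Proof. exact: uea_lift_iota. Qed.

Let phi_EX : map_mx phi (EX F m) = emb_mx Ug k^T *m EX F m *m emb_mx Ug (invmx k)^T.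
Proof.
apply/matrixP => i j; rewrite emb_conjE !mxE phi_iota.
have -> : Ad_K k (delta_mx i j, 0) = (Ad_gl k (delta_mx i j), 0).
  by congr (_, _); rewrite /Ad_gl mulmx0 mul0mx.
rewrite (linear_mxE (g := fun M => uea_iota ((M, 0) : lie_g F m))) => [|a x y]; last first.
  have [lin _] := uea_iota_rep (lie_g F m); rewrite -lin; congr uea_iota.
  by congr (_, _); rewrite /= scaler0 addr0.
apply: eq_bigr => a _; apply: eq_bigr => b _.
by rewrite Ad_gl_delta !mxE.
Qed.

(** The second factor is acted on by the inverse transpose, so that its transpose
    undergoes the same conjugation as [EX]. *)
Let phi_EY : map_mx phi (EY F m)^T =
  emb_mx Ug k^T *m (EY F m)^T *m emb_mx Ug (invmx k)^T.
Proof.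
apply/matrixP => i j; rewrite emb_conjE !mxE phi_iota.
have -> : Ad_K k (0, delta_mx j i) = (0, Ad_gl (invmx k)^T (delta_mx j i)).
  by congr (_, _); rewrite /Ad_gl mulmx0 mul0mx.
rewrite (linear_mxE (g := fun M => uea_iota ((0, M) : lie_g F m))) => [|a x y]; last first.
  have [lin _] := uea_iota_rep (lie_g F m); rewrite -lin; congr uea_iota.
  by congr (_, _); rewrite /= scaler0 addr0.
rewrite exchange_big; apply: eq_bigr => a _; apply: eq_bigr => b _.
by rewrite Ad_gl_delta -trmx_inv invmxK !mxE mulrC.
Qed.

Lemma X_elt_invariant d : phi (X_elt F m p q d) = X_elt F m p q d.
Proof.
rewrite /X_elt; set c := (_ / 2).
under eq_bigr do rewrite symdet_minor.
rewrite -scaler_sumr linearZ linear_sum /=; congr (_ *: _).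
set M := _ - _.
have kk : (invmx k)^T *m k^T = 1%:M by rewrite -trmx_mul mulmxV // trmx1.
rewrite (eq_bigr (fun S => 1 *: phi (altsum (fun=> M) S S))) => [|S _]; last first.
  by rewrite scale1r.
rewrite [RHS](eq_bigr (fun S => 1 *: altsum (fun=> M) S S)) => [|S _]; last first.
  by rewrite scale1r.
apply: (sum_altsum_conj (w := fun=> 1) (phi := phi) (M := fun=> M) kk) => // _.
rewrite /M map_mxB map_mxD phi_EX phi_EY mulmxBr mulmxBl mulmxDr mulmxDl.
congr (_ - _); rewrite map_scalar_mx /= linearZ /= rmorph1.
have -> : (c%:A : Ug)%:M = map_mx (in_alg Ug) c%:M :> 'M_m by rewrite map_scalar_mx.
rewrite !emb_mxE -!map_mxM mul_mx_scalar -scalemxAl (mulmx1C kk).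
by rewrite scalemx1.
Qed.

End InvarianceX.

Section InvarianceC.
Variables (F : numClosedFieldType) (m p q : nat).
Notation Um := (uea (lie_m F p q)).

(** The coefficient [coef] of a tuple that need not be increasing; it only depends
    on how many indices fall in each block, hence is constant along the action of
    a block diagonal matrix. *)
Definition type_weight d l (f : {ffun 'I_l -> 'I_(p + q)}) : F :=
  (coef_ab d #|[set k | (f k < p)%N]| #|[set k | (p <= f k)%N]|)%:~R.

Lemma type_weight_elt d l (J : idx (p + q) l) :
  type_weight d [ffun k => elt J k] = (coef d J)%:~R.
Proof.
by congr (_%:~R); congr coef_ab; apply: eq_card => k; rewrite !inE ffunE.
Qed.

Lemma type_weight_perm d l (f : {ffun 'I_l -> 'I_(p + q)}) (s : 'S_l) :
  type_weight d [ffun k => f (s k)] = type_weight d f.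
Proof.
have cardP (P : pred 'I_l) : #|[set k | P (s k)]| = #|[set k | P k]|.
  rewrite -[LHS](card_imset _ (@perm_inj _ s)); apply: eq_card => k; rewrite inE.
  apply/imsetP/idP => [[j + ->]|Pk]; first by rewrite inE.
  by exists ((s^-1)%g k); rewrite ?inE permKV.
rewrite /type_weight -(cardP (fun k => (f k < p)%N)) -(cardP (fun k => (p <= f k)%N)).
by congr (_%:~R); congr coef_ab; apply: eq_card => k; rewrite !inE ffunE.
Qed.

Lemma type_weight_eq d l (f g : {ffun 'I_l -> 'I_(p + q)}) :
  (forall k, (f k < p)%N = (g k < p)%N) -> type_weight d f = type_weight d g.
Proof.
move=> fg; congr (_%:~R); congr coef_ab; apply: eq_card => k; rewrite !inE //.
by rewrite leqNgt fg -leqNgt.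
Qed.

(** The normalization [- m/2] and the diagonal shifts of [symdet_pq] are both
    multiples of [I_pq]; they are collected in one constant [c]. *)
Definition shifted_B (c : F) : 'M[Um]_(p + q) :=
  Bmx F p q + emb_mx Um (c *: I_pq F p q).

Lemma C_eltE d : C_elt F m p q d =
  \sum_(0 <= l < d.+1) (coef_fact F m d l * (l`!%:R)^-1) *:
    \sum_(J : idx (p + q) l) type_weight d [ffun k => elt J k] *:
      altsum (fun k : 'I_l => shifted_B ((l.-1 - k)%:R - m%:R / 2)) J J.
Proof.
apply: eq_bigr => l _; rewrite -[RHS]scalerA; congr (_ *: _); rewrite scaler_sumr.
apply: eq_bigr => J _; rewrite type_weight_elt symdet_pqE.
rewrite [LHS]scalerA [RHS]scalerA [X in X *: _]mulrC; congr (_ *: _).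
apply: eq_altsum => k i j.
by rewrite !mxE mulrBl scalerBl addrAC addrA.
Qed.

Variables (h1 : 'M[F]_p) (h2 : 'M[F]_q) (h1u : h1 \in unitmx) (h2u : h2 \in unitmx).
Let phi : {lrmorphism Um -> Um} := uea_map (Ad_H_hom h1u h2u).
Let A : 'M[F]_(p + q) := (block_mx h1 0 0 h2)^T.
Let B : 'M[F]_(p + q) := (invmx (block_mx h1 0 0 h2))^T.

Let h_unit : block_mx h1 0 0 h2 \in unitmx.
Proof. by rewrite unitmxE det_ublock unitrM -!unitmxE h1u h2u. Qed.

Let BA : B *m A = 1%:M.
Proof. by rewrite -trmx_mul mulmxV ?h_unit // trmx1. Qed.

Let AB : A *m B = 1%:M.
Proof. exact: mulmx1C. Qed.

Let phi_B' : map_mx phi (B'mx F p q) = emb_mx Um A *m B'mx F p q *m emb_mx Um B.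
Proof.
apply/matrixP => i j; rewrite emb_conjE 2!mxE.
rewrite [LHS](uea_lift_iota (lie_hom_rep (Ad_H_hom h1u h2u))).
rewrite (linear_mxE (g := fun M => uea_iota (M : lie_m F p q))) => [|a x y]; last first.
  by have [lin _] := uea_iota_rep (lie_m F p q); rewrite -lin.
apply: eq_bigr => a _; apply: eq_bigr => b _.
by rewrite Ad_gl_delta !mxE.
Qed.

(** Both [Dmx] and [I_pq] are scalar on each block, so that they commute with
    the group element and with its inverse. *)
Let diag_comm a b : let D := block_mx a%:M 0 0 b%:M in
  (A *m D = D *m A) * (B *m D = D *m B).
Proof.
move=> D; have AD : A *m D = D *m A.
  rewrite /A tr_block_mx !trmx0 !mulmx_block !mulmx0 !mul0mx !addr0 !add0r.
  by rewrite !scalar_mxC.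
split=> //; rewrite -[LHS]mulmx1 -AB -mulmxA (mulmxA D) -AD.
by rewrite !mulmxA BA mul1mx.
Qed.

Let phi_shifted_B c :
  map_mx phi (shifted_B c) = emb_mx Um A *m shifted_B c *m emb_mx Um B.
Proof.
have [AD BD] := diag_comm 1 (- 'i).
have [AI BI] : (A *m (c *: I_pq F p q) = (c *: I_pq F p q) *m A) *
               (B *m (c *: I_pq F p q) = (c *: I_pq F p q) *m B).
  have -> : c *: I_pq F p q = block_mx c%:M 0 0 (- c)%:M.
    by rewrite scale_block_mx !scaler0 scalerN -scaleNr !scalemx1.
  exact: diag_comm.
have phi_emb (C : 'M[F]_(p + q)) : map_mx phi (emb_mx Um C) = emb_mx Um C.
  by apply/matrixP => i j; rewrite !mxE linearZ /= rmorph1.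
rewrite /shifted_B map_mxD phi_emb mulmxDr mulmxDl; congr (_ + _).
  rewrite /Bmx !map_mxM phi_emb phi_B' !emb_mxE.
  rewrite -!mulmxA -(map_mxM (in_alg Um) B) BD map_mxM !mulmxA.
  by rewrite -(map_mxM (in_alg Um) _ A) -AD map_mxM.
by rewrite !emb_mxE -!map_mxM AI -mulmxA AB mulmx1.
Qed.

Lemma C_elt_invariant d : phi (C_elt F m p q d) = C_elt F m p q d.
Proof.
rewrite C_eltE linear_sum; apply: eq_bigr => l _; rewrite linearZ linear_sum /=.
congr (_ *: _); under eq_bigr do rewrite linearZ /=.
apply: (sum_altsum_conj (phi := phi)
  (M := fun k => shifted_B ((l.-1 - k)%:R - m%:R / 2)) BA) => [f s|f u Afu|k].
- exact: type_weight_perm.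
- apply: type_weight_eq => k; have := Afu k; rewrite /A mxE.
  case: (split_ordP (f k)) => i ->; case: (split_ordP (u k)) => j ->.
  + by [].
  + by rewrite block_mxEdl mxE eqxx.
  + by rewrite block_mxEur mxE eqxx.
  by [].
exact: phi_shifted_B.
Qed.

End InvarianceC.

(** * Images in the Weyl algebra *)

Section WeilRepresentation.
Variables (F : numClosedFieldType) (m p q : nat).
Notation P := (Pmx F m p q).
Notation Q := (Qmx F m p q).
Notation PDV := (PDV F m p q).

Definition left_block : {set 'I_(p + q)} := [set a : 'I_(p + q) | (a < p)%N].

Lemma coef_left_block d l (J : idx (p + q) l) :
  coef d J = coef_set left_block d (val J).
Proof.
rewrite /coef /coef_set -(card_imset _ (@elt_inj _ _ J)).
rewrite -[X in coef_ab _ _ X](card_imset _ (@elt_inj _ _ J)).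
have sub (T : pred 'I_(p + q)) :
    [set elt J i | i in [set i | T (elt J i)]] = val J :&: [set a | T a].
  apply/setP => a; rewrite !inE -{1}(elt_permK J 1).
  apply/imsetP/andP => [[i + ->]|[/imsetP[i _ ->]]].
    rewrite inE => Ti; split=> //; apply/imsetP; exists i => //.
    by rewrite ffunE perm1.
  by rewrite ffunE perm1 => Ti; exists i; rewrite ?inE.
rewrite (sub (fun a => (a < p)%N)) (sub (fun a => (p <= a)%N)).
congr coef_ab; apply: eq_card => a; rewrite !inE // andbC.
by rewrite -leqNgt.
Qed.

Lemma weil_PP s t a b : P s a * P t b = P t b * P s a.
Proof.
rewrite /Pmx; case: (split_ordP a) => {}a ->; case: (split_ordP b) => {}b ->;
  rewrite ?row_mxEl ?row_mxEr.
- exact: Xmx_Xmx.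
- by rewrite dY_X.
- by rewrite dY_X.
exact: dY_dY.
Qed.

Lemma weil_QQ s t a b : Q s a * Q t b = Q t b * Q s a.
Proof.
rewrite /Qmx; case: (split_ordP a) => {}a ->; case: (split_ordP b) => {}b ->;
  rewrite ?row_mxEl ?row_mxEr.
- exact: dX_dX.
- by rewrite dX_Y.
- by rewrite dX_Y.
exact: Ymx_Ymx.
Qed.

Lemma weil_QP s t a b : Q t b * P s a = P s a * Q t b +
  1 *~ (((s == t) && (a == b))%:R * block_sign left_block a).
Proof.
have alg1 (e : bool) : (e%:R : F)%:A = e%:R :> PDV by rewrite scaler_nat; case: e.
rewrite /Pmx /Qmx /block_sign inE.
case: (split_ordP a) => {}a ->; case: (split_ordP b) => {}b ->;
  rewrite ?row_mxEl ?row_mxEr /= ?ltn_ord.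
- rewrite (inj_eq (@lshift_inj _ _)) mulr1 mulrz_nat [RHS]addrC; apply/eqP.
  by rewrite -subr_eq dX_X alg1 [t == s]eq_sym [b == a]eq_sym.
- by rewrite eq_lrshift andbF mul0r mulr0z addr0 Xmx_Ymx.
- by rewrite eq_rlshift andbF mul0r mulr0z addr0 dX_dY.
rewrite (inj_eq (@rshift_inj _ _)) /= mulrN1 mulrNz mulrz_nat.
by rewrite -alg1 -dY_Y opprB addrC subrK.
Qed.

(** The constants [p/2] and [q/2] of the representation combine with the shift
    [(p - q)/2] to [q], which is what moving [Y] to the right of [dY] produces. *)
Lemma omega_X c s t : c = (p%:R - q%:R) / 2 ->
  omega_g F m p q ((EX F m + (EY F m)^T - (c%:A)%:M) s t) =
  \sum_a P s a * Q t a.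
Proof.
move=> ->; rewrite !mxE rmorphB rmorphD /= omega_gEX omega_gEY rmorphMn /=.
rewrite linearZ /= rmorph1 big_split_ord /=.
rewrite /weilX /weilY !mxE.
under [in RHS]eq_bigr do rewrite row_mxEl row_mxEl.
under [X in _ = _ + X]eq_bigr do rewrite row_mxEr row_mxEr.
have dYY i : dY F m p q s i * Ymx F m p q t i =
    Ymx F m p q t i * dY F m p q s i + ((s == t)%:R : F)%:A.
  by apply/eqP; rewrite addrC -subr_eq dY_Y eqxx andbT.
under [X in _ = _ + X]eq_bigr do rewrite dYY.
rewrite big_split /= sumr_const card_ord -!addrA; congr (_ + _).
rewrite addrCA; congr (_ + _).
rewrite !scalerMnl -scaleNr -!scalerDl; congr (_ *: _).
by rewrite [t == s]eq_sym -mulr_natl -[X in _ - X]mulr_natl; field.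
Qed.

Lemma Dmx_diag a b : a != b -> Dmx F p q a b = 0.
Proof.
rewrite /Dmx; case: (split_ordP a) => i ->; case: (split_ordP b) => j ->.
- by rewrite (inj_eq (@lshift_inj _ _)) block_mxEul mxE => /negPf ->.
- by rewrite block_mxEur mxE.
- by rewrite block_mxEdl mxE.
by rewrite (inj_eq (@rshift_inj _ _)) block_mxEdr mxE => /negPf ->.
Qed.

Lemma Dmx_conj (U : algType F) (M : 'M[U]_(p + q)) a b :
  (emb_mx U (Dmx F p q) *m M *m emb_mx U (Dmx F p q)) a b =
  (Dmx F p q a a * Dmx F p q b b) *: M a b.
Proof.
rewrite emb_conjE (bigD1 a) //= (bigD1 b) //= [X in _ + X + _]big1 => [|j jb]; last first.
  by rewrite (Dmx_diag jb) mulr0 scale0r.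
rewrite [X in _ + X]big1 ?addr0 // => i ia; rewrite big1 // => j _.
by rewrite (Dmx_diag (a := a)) 1?eq_sym // mul0r scale0r.
Qed.

Lemma Dmx_phi s a : Dmx F p q a a *: wphi F m p q s a = P s a.
Proof.
rewrite /wphi /Pmx /Dmx; case: (split_ordP a) => i ->.
  by rewrite !row_mxEl block_mxEul mxE eqxx scale1r.
rewrite !row_mxEr block_mxEdr mxE eqxx [map_mx _ _ _ _]mxE scalerA mulNr -expr2 sqrCi.
by rewrite opprK scale1r.
Qed.

Lemma Dmx_psi s a : Dmx F p q a a *: wpsi F m p q s a = Q s a.
Proof.
rewrite /wpsi /Qmx /Dmx; case: (split_ordP a) => i ->.
  by rewrite !row_mxEl block_mxEul mxE eqxx scale1r.
rewrite !row_mxEr block_mxEdr mxE eqxx [map_mx _ _ _ _]mxE scalerA mulNr -expr2 sqrCi.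
by rewrite opprK scale1r.
Qed.

Lemma Dmx_sq a : Dmx F p q a a * Dmx F p q a a = (block_sign left_block a)%:~R.
Proof.
rewrite /Dmx /block_sign inE; case: (split_ordP a) => i ->.
  by rewrite block_mxEul mxE eqxx mulr1.
by rewrite block_mxEdr mxE eqxx mulrNN -expr2 sqrCi.
Qed.

Lemma I_pqE a b : I_pq F p q a b = (a == b)%:R * (block_sign left_block a)%:~R.
Proof.
rewrite /I_pq /block_sign inE; case: (split_ordP a) => i ->; case: (split_ordP b) => j ->.
- by rewrite (inj_eq (@lshift_inj _ _)) block_mxEul mxE mulr1.
- by rewrite block_mxEur mxE eq_lrshift mul0r.
- by rewrite block_mxEdl mxE eq_rlshift mul0r.
by rewrite (inj_eq (@rshift_inj _ _)) block_mxEdr !mxE mulrN1.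
Qed.

(** [Dmx] turns the canonical variables [wphi], [wpsi] into [P], [Q], and
    the constant [m/2] of the representation into [m/2] times [I_pq], which the
    normalization removes. *)
Lemma omega_B r a b :
  omega_m F m p q (shifted_B p q (r%:R - m%:R / 2) a b) =
  \sum_s P s a * Q s b + ((a == b)%:R *~ block_sign left_block a) *+ r.
Proof.
have W : weilM F m p q a b = \sum_s wphi F m p q s a * wpsi F m p q s b +
    (m%:R / 2 * (a == b)%:R : F)%:A by rewrite weilM_ccr mxE.
rewrite mxE rmorphD /= Dmx_conj linearZ /= [B'mx _ _ _ _ _]mxE omega_mE W.
rewrite [emb_mx _ _ _ _]mxE [(_ *: I_pq _ _ _) _ _]mxE I_pqE linearZ /= rmorph1.
rewrite scalerDr scaler_sumr -addrA; congr (_ + _).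
  apply: eq_bigr => s _; rewrite -Dmx_phi -Dmx_psi.
  by rewrite -scalerAl -scalerAr scalerA.
rewrite scalerA -scalerDl; case: (eqVneq a b) => [<-|_].
  rewrite Dmx_sq !mulr1 !mul1r -mulrC -mulrDl addrC subrK.
  by rewrite -scalerA scaler_int scaler_nat.
by rewrite !(mulr0, mul0r) addr0 scale0r mul0rz mul0rn.
Qed.

Lemma sum_scale_coef d l (V : lmodType F) (h : idx (p + q) l -> V) :
  \sum_J (coef d J)%:~R *: h J =
  \sum_J h J *~ coef_set left_block d (val J).
Proof.
by apply: eq_bigr => J _; rewrite scaler_int coef_left_block.
Qed.

Lemma omega_X_elt d : (d <= m)%N ->
  omega_g F m p q (X_elt F m p q d) = weil_image F m p q d.
Proof.
move=> dm; rewrite /X_elt; set M := (_ - _).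
rewrite (eq_bigr _ (fun S _ => symdet_minor M S)) -scaler_sumr linearZ linear_sum /=.
under eq_bigr => S _ do rewrite rmorph_altsum.
rewrite (eq_bigr (fun S => altsum (fun=> (fun s t => \sum_a P s a * Q t a)) S S)); last first.
  by move=> S _; apply: eq_altsum => _ s t; apply: omega_X.
rewrite (sum_principal_altsum weil_PP weil_QQ weil_QP) scaler_sumr.
apply: eq_big_nat => l /andP[_ ld]; rewrite sum_scale_coef -scaler_nat scalerA.
congr (_ *: _); rewrite /coef_fact.
have -> : ((m - l)`!%:R : F) = ((m - l) ^_ (d - l))%:R * (m - d)`!%:R.
  rewrite -natrM -(@ffact_fact (m - l) (d - l)) ?leq_sub2r //.
  by rewrite subnBA // subnK // (leq_trans _ dm).
have f0 k : (k`!%:R : F) != 0 by rewrite pnatr_eq0 -lt0n fact_gt0.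
by field; rewrite !f0.
Qed.

Lemma omega_C_elt d : omega_m F m p q (C_elt F m p q d) = weil_image F m p q d.
Proof.
rewrite C_eltE linear_sum; apply: eq_bigr => l _; rewrite linearZ linear_sum /=.
rewrite -scalerA; congr (_ *: _); rewrite scaler_sumr; apply: eq_bigr => J _.
rewrite linearZ /= rmorph_altsum type_weight_elt.
rewrite (eq_altsum _ _ (fun k a b => omega_B (l.-1 - k) a b)).
rewrite (capelli_altsum weil_PP weil_QQ weil_QP) -scaler_nat !scalerA; congr (_ *: _).
have f0 k : (k`!%:R : F) != 0 by rewrite pnatr_eq0 -lt0n fact_gt0.
by field; rewrite f0.
Qed.

End WeilRepresentation.

Theorem theorem2p2 (R : realType) (m p q d : nat)
    (m_gt0 : (0 < m)%N) (d_gt0 : (0 < d)%N) (d_le_m : (d <= m)%N) :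
  [/\ K_invariant (X_elt R[i] m p q d),
      H_invariant (C_elt R[i] m p q d),
      omega_g R[i] m p q (X_elt R[i] m p q d) = weil_image R[i] m p q d
    & weil_image R[i] m p q d = omega_m R[i] m p q (C_elt R[i] m p q d)].
Proof.
split; first by move=> k hk; apply: X_elt_invariant.
- by move=> h1 h2 h1u h2u; apply: C_elt_invariant.
- exact: omega_X_elt.
by rewrite omega_C_elt.
Qed.
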